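(* For any integer $n\ge 2$, \[ P_{n,2}^{\max} = \begin{cases}1 & n+1 \text{ odd}\\ 2p_t & n+1\equiv 2\pmod 4\\ p_t & n+1\equiv 0 \pmod 4\end{cases}, \] where $t$ is the odd part of $n+1$ and $p_t = \prod_{d\mid t}\left(1 - 2^{-o_d(2)}\right)^{\phi(d)/o_d(2)}$. For any odd prime $p$ and $n\ge 2$, \[ P_{n,p}^{\max} = 1 - \frac{1}{p^2+p+1} + O\left(\sum_{d=0}^{\lfloor n/2\rfloor}\delta_{n,p}(2d) + \frac{1}{p^n}\right), \] where the implied constant is absolute.
   Context: For odd $d$, $o_d(2)$ is the order of $2$ in $(\mathbb{Z}/d\mathbb{Z})^\times$; $\phi$ is Euler's function. For a prime $p$, let $U_n(\mathbb{Z}_p)$ be the set of monic degree $n$ polynomials in $\mathbb{Z}_p[x]$ all of whose coefficients are not divisible by $p$, viewed via its non-leading coefficients as a subset of $\mathbb{Z}_p^n$ with normalized Haar measure $\lambda_p$. $P_{n,p}^{\max} = \lambda_p(\{f\in U_n(\mathbb{Z}_p): \mathbb{Z}_p[x]/(f(x)) \text{ is the maximal order of } \mathbb{Q}_p[x]/(f(x))\})/\lambda_p(U_n(\mathbb{Z}_p))$. Let $\mathbb{F}_p[x]_m$ be the set of monic polynomials in $\mathbb{F}_p[x]$. For $u\in\mathbb{F}_p[x]_m$ and $\alpha\in\mathbb{F}_p[x]/(u)$, let $\mathcal{A}_n(u;\alpha) = \{(a_1,\ldots,a_n)\in(\mathbb{F}_p\setminus\{0\})^n : a_1x^{n-1}+\cdots+a_n\equiv\alpha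 \bmod u\}$, and \[ \delta_{n,p}(d) = \max_{\substack{u\in\mathbb{F}_p[x]_m,\ \deg u = d,\ x\nmid u}}\ \max_{\alpha\in\mathbb{F}_p[x]/(u)}\left|\frac{|\mathcal{A}_n(u;\alpha)|}{(p-1)^n} - \frac{1}{p^d}\right|. \] *)

(* Defs.v *)
From HB Require Import structures.
From mathcomp Require Import all_boot all_order all_fingroup all_algebra.
From mathcomp Require Import all_classical all_reals all_analysis.

Set Implicit Arguments.
Unset Strict Implicit.
Unset Printing Implicit Defensive.

Import Order.TTheory GRing.Theory Num.Theory.

Local Open Scope classical_set_scope.
Local Open Scope ring_scope.

(* The ring of p-adic integers, as the inverse limit of the rings Z/p^(k+1)Z. *)

Lemma Zp_natK m m' n : (1 < m)%N -> (1 < m')%N -> (m %| m')%N ->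
  ((n%:R : 'Z_m') : nat)%:R = n%:R :> 'Z_m.
Proof.
move=> m1 m'1 mm'; rewrite val_Zp_nat //.
by rewrite -(Zp_nat_mod m1 (n %% m')) modn_dvdm // Zp_nat_mod.
Qed.

(* The primality proof is a parameter of the type so that the domain          *)
(* structure can be inferred from it.                                         *)
Record padic_int (p : nat) (p_pr : prime p) := PadicInt {
  padic_res : forall k : nat, 'Z_(p ^ k.+1);
  padic_resP : forall k, ((padic_res k.+1 : nat)%:R : 'Z_(p ^ k.+1))
                           = padic_res k }.

Section PadicInt.
Variables (p : nat) (p_pr : prime p).

Let q_gt1 k : (1 < p ^ k.+1)%N.
Proof. by rewrite -(exp1n k.+1) ltn_exp2r ?prime_gt1. Qed.

Let q_dvd k : (p ^ k.+1 %| p ^ k.+2)%N.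
Proof. by rewrite dvdn_exp2l. Qed.

Local Notation padic_int := (padic_int p_pr).
Implicit Types x y z : padic_int.

Lemma padic_eq x y : (forall k, padic_res x k = padic_res y k) -> x = y.
Proof.
case: x y => [x xP] [y yP] /= xy.
have {}xy : x = y by exact: functional_extensionality_dep.
by subst y; congr PadicInt; exact: Prop_irrelevance.
Qed.

HB.instance Definition _ := gen_eqMixin padic_int.
HB.instance Definition _ := gen_choiceMixin padic_int.

Let coh k (n : 'Z_(p ^ k.+2)) (m : 'Z_(p ^ k.+1)) (N : nat) :
  n = N%:R -> m = N%:R -> (n : nat)%:R = m.
Proof. by move=> -> ->; exact: Zp_natK. Qed.

Let resE x k : padic_res x k.+1 = (padic_res x k.+1 : nat)%:R.
Proof. by rewrite natr_Zp. Qed.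

Fact padic_natP (n : nat) k :
  (((n%:R : 'Z_(p ^ k.+2)) : nat)%:R : 'Z_(p ^ k.+1)) = n%:R.
Proof. exact: (@coh k _ _ n). Qed.
Definition padic_nat (n : nat) :=
  @PadicInt p p_pr (fun k => n%:R) (padic_natP n).

Fact padic_addP x y k :
  ((nat_of_ord (padic_res x k.+1 + padic_res y k.+1))%:R : 'Z_(p ^ k.+1))
    = padic_res x k + padic_res y k.
Proof.
apply: (@coh k _ _ (padic_res x k.+1 + padic_res y k.+1)%N).
  by rewrite natrD -!resE.
by rewrite natrD !padic_resP.
Qed.
Definition padic_add x y := @PadicInt p p_pr
  (fun k => padic_res x k + padic_res y k) (padic_addP x y).

Fact padic_mulP x y k :
  ((nat_of_ord (padic_res x k.+1 * padic_res y k.+1))%:R : 'Z_(p ^ k.+1))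
    = padic_res x k * padic_res y k.
Proof.
apply: (@coh k _ _ (padic_res x k.+1 * padic_res y k.+1)%N).
  by rewrite natrM -!resE.
by rewrite natrM !padic_resP.
Qed.
Definition padic_mul x y := @PadicInt p p_pr
  (fun k => padic_res x k * padic_res y k) (padic_mulP x y).

Fact padic_oppP x k :
  ((nat_of_ord (- padic_res x k.+1))%:R : 'Z_(p ^ k.+1)) = - padic_res x k.
Proof.
have E l : (l <= k.+1)%N -> (p ^ k.+2 - 1)%:R = -1 :> 'Z_(p ^ l.+1).
  move=> lk; rewrite natrB ?expn_gt0 ?prime_gt0 //.
  have /dvdnP[m ->] : (p ^ l.+1 %| p ^ k.+2)%N by rewrite dvdn_exp2l.
  by rewrite natrM pchar_Zp // mulr0 sub0r.
apply: (@coh k _ _ ((p ^ k.+2 - 1) * padic_res x k.+1)%N).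
  by rewrite natrM E // mulN1r -resE.
by rewrite natrM E // mulN1r padic_resP.
Qed.
Definition padic_opp x := @PadicInt p p_pr
  (fun k => - padic_res x k) (padic_oppP x).

Fact padic_addA : associative padic_add.
Proof. by move=> x y z; apply: padic_eq => k /=; rewrite addrA. Qed.
Fact padic_addC : commutative padic_add.
Proof. by move=> x y; apply: padic_eq => k /=; rewrite addrC. Qed.
Fact padic_add0 : left_id (padic_nat 0) padic_add.
Proof. by move=> x; apply: padic_eq => k /=; rewrite add0r. Qed.
Fact padic_addN : left_inverse (padic_nat 0) padic_opp padic_add.
Proof. by move=> x; apply: padic_eq => k /=; rewrite addNr. Qed.

HB.instance Definition _ := GRing.isZmodule.Build padic_int
  padic_addA padic_addC padic_add0 padic_addN.

Fact padic_mulA : associative padic_mul.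
Proof. by move=> x y z; apply: padic_eq => k /=; rewrite mulrA. Qed.
Fact padic_mulC : commutative padic_mul.
Proof. by move=> x y; apply: padic_eq => k /=; rewrite mulrC. Qed.
Fact padic_mul1 : left_id (padic_nat 1) padic_mul.
Proof. by move=> x; apply: padic_eq => k /=; rewrite mul1r. Qed.
Fact padic_mulD : left_distributive padic_mul +%R.
Proof. by move=> x y z; apply: padic_eq => k /=; rewrite mulrDl. Qed.
Fact padic_1neq0 : padic_nat 1 != 0.
Proof.
by apply/eqP => /(congr1 (fun z => padic_res z 0%N)) /= /eqP; rewrite oner_eq0.
Qed.

HB.instance Definition _ := GRing.Zmodule_isComNzRing.Build padic_int
  padic_mulA padic_mulC padic_mul1 padic_mulD padic_1neq0.

Definition padic_unit : {pred padic_int} :=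
  fun x => `[< exists y : padic_int, y * x = 1 >].
Definition padic_inv x : padic_int :=
  if pselect (exists y : padic_int, y * x = 1) is left h
  then projT1 (cid h) else x.

Fact padic_mulV : {in padic_unit, left_inverse 1 padic_inv *%R}.
Proof.
move=> x /asboolP ux; rewrite /padic_inv.
by case: pselect => // h; exact: (projT2 (cid h)).
Qed.
Fact padic_unitP x y : y * x = 1 -> padic_unit x.
Proof. by move=> yx; apply/asboolP; exists y. Qed.
Fact padic_invN : {in [predC padic_unit], padic_inv =1 id}.
Proof. by move=> x /asboolPn ux; rewrite /padic_inv; case: pselect. Qed.

HB.instance Definition _ := GRing.ComNzRing_hasMulInverse.Build padic_int
  padic_mulV padic_unitP padic_invN.

Lemma padic_res_le x k l : (k <= l)%N ->
  ((padic_res x l : nat)%:R : 'Z_(p ^ k.+1)) = padic_res x k.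
Proof.
elim: l => [|l IH]; first by rewrite leqn0 => /eqP ->; rewrite natr_Zp.
rewrite leq_eqVlt => /orP[/eqP -> |]; first by rewrite natr_Zp.
rewrite ltnS => kl; rewrite -(IH kl) -(padic_resP x l).
by rewrite Zp_natK // dvdn_exp2l.
Qed.

Fact padic_domain : GRing.integral_domain_axiom padic_int.
Proof.
have nz0 x : x != 0 -> exists k, forall l, (k <= l)%N ->
    (0 < padic_res x l)%N /\ (logn p (padic_res x l) <= k)%N.
  move=> x0; have [k xk] : exists k, padic_res x k != 0.
    apply: contrapT => /forallNP xk; move/eqP: x0; apply.
    by apply: padic_eq => k; apply: contrapT => /eqP; exact: xk.
  exists k => l kl; have xlk : ~~ (p ^ k.+1 %| padic_res x l)%N.
    apply: contra xk => /dvdnP[m e]; rewrite -(padic_res_le x kl) e natrM.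
    by rewrite pchar_Zp // mulr0.
  have x_gt0 : (0 < padic_res x l)%N.
    by rewrite lt0n; apply: contra xlk => /eqP ->; rewrite dvdn0.
  by split => //; rewrite leqNgt -pfactor_dvdn.
move=> x y xy0; apply: contraT.
rewrite negb_or => /andP[/nz0[k xk] /nz0[l yl]].
have kN : (k <= (k + l).+1)%N by rewrite -addnS leq_addr.
have lN : (l <= (k + l).+1)%N by rewrite -addSn leq_addl.
have [x0 xl] := xk _ kN; have [y0 yk] := yl _ lN.
have : (p ^ (k + l).+2 %| padic_res x (k + l).+1 * padic_res y (k + l).+1)%N.
  rewrite /dvdn -(val_Zp_nat (q_gt1 _)) natrM !natr_Zp.
  by rewrite -[_ * _]/(padic_res (x * y) (k + l).+1) xy0.
rewrite pfactor_dvdn ?muln_gt0 ?x0 // lognM // => /leq_trans/(_ (leq_add xl yk)).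
by rewrite ltnNge leqnSn.
Qed.

HB.instance Definition _ :=
  GRing.ComUnitRing_isIntegral.Build padic_int padic_domain.

HB.instance Definition _ := isPointed.Build padic_int 0.

(* The p-adic topology: the classes modulo p^(k+1) form a neighbourhood base. *)

Definition padic_nbhs x : set (set padic_int) :=
  [set A | exists k, [set y | padic_res y k = padic_res x k] `<=` A].

HB.instance Definition _ := hasNbhs.Build padic_int padic_nbhs.

Fact padic_nbhs_filter x : ProperFilter (nbhs x).
Proof.
split; first by move=> [k /(_ x)]; exact.
split=> [|A B [k kA] [l lB]|A B AB [k kA]].
- by exists 0%N.
- exists (maxn k l) => y /= yx; split.
    by apply: kA => /=; rewrite -!(padic_res_le _ (leq_maxl k l)) yx.
  by apply: lB => /=; rewrite -!(padic_res_le _ (leq_maxr k l)) yx.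
- by exists k; exact: subset_trans AB.
Qed.

Fact padic_nbhs_singleton x (A : set padic_int) : nbhs x A -> A x.
Proof. by move=> [k]; exact. Qed.

Fact padic_nbhs_nbhs x (A : set padic_int) : nbhs x A -> nbhs x (nbhs^~ A).
Proof.
by move=> [k kA]; exists k => y /= yx; exists k => z /= zy; apply: kA; rewrite /= zy.
Qed.

HB.instance Definition _ := Nbhs_isNbhsTopological.Build padic_int
  padic_nbhs_filter padic_nbhs_singleton padic_nbhs_nbhs.

End PadicInt.

Section Orders.
Variables (p : nat) (p_pr : prime p).
Local Notation Zp := (padic_int p_pr).
Local Notation Qp := {fraction Zp}.
Local Notation toQp := (@tofrac Zp).

(* An order of a Qp-algebra K is a subring of K that is finitely generated as *)
(* a Zp-module and spans K over Qp.                                           *)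
Definition is_order (K : comAlgType Qp) (O : set K) : Prop :=
  [/\ [/\ O 1, (forall a b, O a -> O b -> O (a - b))
        & (forall a b, O a -> O b -> O (a * b))],
      (exists (m : nat) (w : 'I_m -> K),
         O = [set \sum_(i < m) toQp (c i) *: w i | c in [set: 'I_m -> Zp]])
    & (forall a, exists (m : nat) (c : 'I_m -> Qp) (w : 'I_m -> K),
         (forall i, O (w i)) /\ a = \sum_(i < m) c i *: w i)].

Definition is_maximal_order (K : comAlgType Qp) (O : set K) : Prop :=
  is_order O /\ forall O' : set K, is_order O' -> O `<=` O' -> O' = O.

(* {poly %/ h} is the quotient by h only when h is monic and nonconstant,     *)
(* which holds below since f is monic of degree n >= 2. In that case          *)
(* Zp[x]/(f) embeds in Qp[x]/(f), and equation_order f is its image.          *)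
Definition equation_algebra (f : {poly Zp}) : comAlgType Qp :=
  {poly %/ map_poly toQp f}.

Definition equation_order (f : {poly Zp}) : set (equation_algebra f) :=
  [set in_qpoly (map_poly toQp f) (map_poly toQp g) | g in [set: {poly Zp}]].

End Orders.
Arguments equation_order {p p_pr} f _.

Section Pmax.
Variables (p : nat) (p_pr : prime p) (n : nat).
Local Notation Zp := (padic_int p_pr).

(* The coefficient of x^i is c 0 i for i < n, and 1 for i = n. *)
Definition monic_of (c : 'rV[Zp]_n) : {poly Zp} :=
  'X^n + \sum_(i < n) c 0 i *: 'X^i.

(* The leading coefficient 1 is never divisible by p. *)
Definition U_set : set 'rV[Zp]_n :=
  [set c | forall i, ~ exists z : Zp, c 0 i = p%:R * z].

Definition max_set : set 'rV[Zp]_n :=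
  [set c | is_maximal_order (equation_order (monic_of c))].

End Pmax.
Arguments U_set {p} p_pr n _.
Arguments max_set {p} p_pr n _.

Notation borel_padic p_pr n :=
  (g_sigma_algebraType (@open 'rV[padic_int p_pr]_n)).

(* Normalization is part of mu being a probability measure. *)
Definition is_haar (R : realType) (p : nat) (p_pr : prime p) (n : nat)
    (mu : probability (borel_padic p_pr n) R) : Prop :=
  forall (v : 'rV[padic_int p_pr]_n) (A : set 'rV[padic_int p_pr]_n),
    measurable (A : set (borel_padic p_pr n)) ->
    mu [set v + u | u in A] = mu A.

Definition Pmax (R : realType) (p : nat) (p_pr : prime p) (n : nat)
    (mu : probability (borel_padic p_pr n) R) : R :=
  fine (mu (U_set p_pr n `&` max_set p_pr n))
    / fine (mu (U_set p_pr n)).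

(* The order of 2 in (Z/dZ)^*, for d odd. Since 'Z_1 is Z/2Z rather than the  *)
(* zero ring, the trivial group (Z/1Z)^* is dealt with separately.            *)
Definition ord2 (d : nat) : nat :=
  if (d <= 1)%N then 1%N
  else #[insubd (1%g : {unit 'Z_d}) (2%:R : 'Z_d)]%g.

Definition p_t (R : realType) (t : nat) : R :=
  \prod_(d <- divisors t) (1 - 2^-1 ^+ ord2 d) ^+ (totient d %/ ord2 d).

(* a i stands for the coefficient a_(i+1) of x^(n-(i+1)). *)
Definition A_set (p n : nat) (u alpha : {poly 'F_p}) : {set {ffun 'I_n -> 'F_p}} :=
  [set a : {ffun 'I_n -> 'F_p} | [forall i, a i != 0] &&
    ((\sum_(i < n) a i *: 'X^(n - i.+1)) %% u == alpha %% u)].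

(* The classes alpha of F_p[x]/(u), for deg u = d, are given by their         *)
(* representatives of degree < d. All the terms are nonnegative, so the       *)
(* default value 0 does not affect the maxima.                                *)
Definition delta (R : realType) (n p d : nat) : R :=
  \big[Num.max/0]_(u : {poly_(d.+1) 'F_p} |
      [&& polyn u \is monic, size (polyn u) == d.+1 & ~~ ('X %| polyn u)])
    \big[Num.max/0]_(alpha : {poly_d 'F_p})
      `| #|A_set n (polyn u) (polyn alpha)|%:R / (p.-1)%:R ^+ n
         - 1 / p%:R ^+ d |.

(* Main.v *)
Require Import Defs.
From HB Require Import structures.
From mathcomp Require Import all_boot all_order all_fingroup all_algebra.
From mathcomp Require Import cyclic separable finfield cyclotomic qfpoly.
From mathcomp Require Import all_classical all_reals all_analysis.
From mathcomp Require Import ring zify.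

Set Implicit Arguments.
Unset Strict Implicit.
Unset Printing Implicit Defensive.

Import Order.TTheory GRing.Theory Num.Theory.
Import Pdiv.RingMonic.

Local Open Scope classical_set_scope.
Local Open Scope ring_scope.

(**
By Dedekind's criterion, Z_p[x]/(f) is maximal if and only if f lies in no
(p, u)^2 with u irreducible modulo p; only u with u^2 | f mod p matter. If s is
the product of these u, then f = S^2 A + p W for lifts S and A of s and of
(f mod p)/s^2, and f is in (p, u)^2 exactly when u | W mod p, so that maximality
means that W mod p is prime to s. The mod p^2 digits of the coefficients are
uniform for Haar measure, hence P^max is the average over the admissible
f mod p of the product of 1 - p^(-deg u) over the u with u^2 | f mod p.

For p = 2 the only admissible reduction is (x^(n+1) - 1)/(x - 1), and if
n + 1 = 2^k t with t odd then (x - 1) f = (x^t - 1)^(2^k). The irreducible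
factors u of x^t - 1 are sorted by the order d | t of x modulo u: they have
degree o_d(2), and their degrees add up to phi(d).

For general p the product is expanded into a Moebius sum over the squarefree v
with v^2 | f mod p. The probability of v^2 | f mod p is p^(-2 deg v) up to
delta(2 deg v), and the sum of mu(v) over the monic v of degree d >= 1 prime to
x is 1 - p, because the sum of mu(v) p^(d - deg v) over deg v <= d is 1; the
main term is thus a geometric series.
*)

(** * Reduction of p-adic integers *)

Section PadicResidue.
Variables (p : nat) (p_pr : prime p).
Local Notation Zp := (padic_int p_pr).

Let q_gt1 k : (1 < p ^ k.+1)%N.
Proof. by rewrite -(exp1n k.+1) ltn_exp2r ?prime_gt1. Qed.

Let natr_p0 : (p%:R : 'Z_(p ^ 1)) = 0.
Proof. by rewrite -[RHS](pchar_Zp (q_gt1 0)); congr (_ *+ _);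
  rewrite expn1. Qed.

Lemma padic_resM (x y : Zp) k :
  padic_res (x * y) k = padic_res x k * padic_res y k.
Proof. by []. Qed.

Lemma padic_res_nat k n : padic_res (n%:R : Zp) k = n%:R.
Proof. by elim: n => // n IH; rewrite [in RHS]mulrS -IH mulrS. Qed.

Lemma padic_res_modn (x : Zp) k l : (k <= l)%N ->
  (padic_res x l %% p ^ k.+1)%N = padic_res x k.
Proof. by move=> kl; rewrite -(padic_res_le x kl) val_Zp_nat. Qed.

(** The digits of [y] are those of [x] shifted: the residue of [y] modulo [p^(j+1)] is the residue
    of [x] modulo [p^(j+k+2)], divided by [p^(k+1)]. *)
Lemma padic_res_eq0 (x : Zp) k :
  padic_res x k = 0 -> exists y : Zp, x = (p ^ k.+1)%:R * y.
Proof.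
move=> xk0.
have dv j : (p ^ k.+1 %| padic_res x (j + k.+1)%N)%N.
  by rewrite /dvdn padic_res_modn ?xk0 // (leq_trans (leqnSn k)) ?leq_addl.
pose y j : 'Z_(p ^ j.+1) := (padic_res x (j + k.+1)%N %/ p ^ k.+1)%:R.
have yP j : ((y j.+1 : nat)%:R : 'Z_(p ^ j.+1)) = y j.
  rewrite /y Zp_natK ?dvdn_exp2l // -(Zp_nat_mod (q_gt1 j)).
  rewrite -[in RHS](Zp_nat_mod (q_gt1 j)); congr (_%:R).
  rewrite !modn_divl -!expnD.
  have -> : (j.+1 + k.+1 = (j + k.+1).+1)%N by [].
  by rewrite !padic_res_modn.
exists (@PadicInt p p_pr y yP); apply: padic_eq => j.
transitivity ((p ^ k.+1)%:R * y j : 'Z_(p ^ j.+1)); last first.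
  by rewrite -(padic_res_nat j).
by rewrite /y -natrM mulnC divnK // padic_res_le // leq_addr.
Qed.

Definition red (x : Zp) : 'F_p := (padic_res x 0 : nat)%:R.

Lemma redE (x : Zp) n : padic_res x 0 = n%:R -> red x = n%:R.
Proof.
move=> e; rewrite /red e val_Zp_nat // expn1.
by rewrite -Fp_nat_mod // modn_mod Fp_nat_mod.
Qed.

Lemma red_is_zmod : zmod_morphism red.
Proof.
have redD x y : red (x + y) = red x + red y.
  have -> : red x + red y = (padic_res x 0 + padic_res y 0)%N%:R by rewrite
    natrD.
  by apply: redE; rewrite natrD !natr_Zp.
move=> x y; apply/eqP; rewrite eq_sym subr_eq -redD.
by rewrite subrK.
Qed.

Lemma red_is_monoid : monoid_morphism red.
Proof.
split; first exact: (@redE 1 1).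
move=> x y.
have -> : red x * red y = (padic_res x 0 * padic_res y 0)%N%:R by rewrite natrM.
by apply: redE; rewrite natrM !natr_Zp.
Qed.

HB.instance Definition _ := GRing.isZmodMorphism.Build Zp 'F_p red red_is_zmod.
HB.instance Definition _ := GRing.isMonoidMorphism.Build Zp 'F_p red
  red_is_monoid.

Definition padic_lift (a : 'F_p) : Zp := (a : nat)%:R.

Lemma red_padic_lift : cancel padic_lift red.
Proof. by move=> a; rewrite /padic_lift rmorph_nat natr_Zp. Qed.

Lemma padic_lift0 : padic_lift 0 = 0. Proof. by []. Qed.

Lemma red_p : red p%:R = 0.
Proof. by rewrite rmorph_nat pchar_Fp_0. Qed.

Lemma red_eq0 (x : Zp) : red x = 0 -> exists y : Zp, x = p%:R * y.
Proof.
move=> /eqP; rewrite /red -(dvdn_pcharf (pchar_Fp p_pr)) => /dvdnP [m e].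
have x0 : padic_res x 0 = 0.
  rewrite -(natr_Zp (padic_res x 0)) e mulnC.
  by rewrite natrM natr_p0 mul0r.
by have [y ->] := padic_res_eq0 x0; exists y; rewrite expn1.
Qed.

Lemma p_neq0 : (p%:R : Zp) != 0.
Proof.
apply/eqP => /(congr1 (fun z => (padic_res z 1 : nat))).
rewrite padic_res_nat val_Zp_nat // modn_small /=; last first.
  by rewrite -[X in (X < _)%N]expn1 ltn_exp2l ?prime_gt1.
by move=> e; have := prime_gt0 p_pr; rewrite e.
Qed.

(** Factors [p] are split off by induction on an index at which the residue of [x] is nonzero:
    dividing by [p] lowers that index by one. *)
Lemma padic_p_decomp (x : Zp) : x != 0 ->
  exists k y, red y != 0 /\ x = p%:R ^+ k * y.
Proof.
move=> x0; have [k xk] : exists k, padic_res x k != 0.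
  apply: contrapT => /forallNP xk; move/eqP: x0; apply.
  by apply: padic_eq => k; apply: contrapT => /eqP; exact: xk.
elim: k x xk {x0} => [|k IH] x xk.
  exists 0%N, x; rewrite expr0 mul1r; split=> //.
  apply: contra xk => /eqP /red_eq0 [y ->].
  rewrite padic_resM.
  by rewrite padic_res_nat natr_p0 mul0r.
have [/eqP /red_eq0 [y xE] | rx] := boolP (red x == 0); last first.
  by exists 0%N, x; rewrite expr0 mul1r.
have yk : padic_res y k != 0.
  apply: contra xk => /eqP /padic_res_eq0 [z yE].
  rewrite xE yE mulrA -natrM -expnS.
  rewrite padic_resM.
  by rewrite padic_res_nat pchar_Zp // mul0r.
have [j [z [rz yE]]] := IH y yk.
by exists j.+1, z; rewrite exprS -mulrA -yE.
Qed.

(** Every residue of [x] is then a unit, and uniqueness of inverses makes the inverses a compatible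
    sequence. *)
Lemma padic_unit_red (x : Zp) : red x != 0 -> exists y : Zp, y * x = 1.
Proof.
move=> rx.
have cop k : coprime (p ^ k.+1) (padic_res x k).
  rewrite coprimeXl // prime_coprime //.
  apply: contra rx => /dvdnP [m e].
  rewrite /red -(padic_res_modn x (leq0n k)) e expn1 modnMl.
  by rewrite mulr0n.
have ux k : padic_res x k \is a GRing.unit.
  by rewrite -(natr_Zp (padic_res x k)) unitZpE.
pose y k := (padic_res x k)^-1.
have yP k : ((y k.+1 : nat)%:R : 'Z_(p ^ k.+1)) = y k.
  suff E : (y k.+1 : nat)%:R * padic_res x k = 1.
    by apply: (mulIr (ux k)); rewrite E mulVr ?ux.
  rewrite -(padic_resP x k).
  rewrite -natrM.
  have := Zp_natK (y k.+1 * padic_res x k.+1)%N (q_gt1 k) (q_gt1 k.+1)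
    (dvdn_exp2l _ (leqnSn _)).
  by rewrite natrM !natr_Zp mulVr ?ux // => <-; rewrite val_Zp_nat.
by exists (@PadicInt p p_pr y yP); apply: padic_eq => k; exact: mulVr (ux k).
Qed.

End PadicResidue.

(** * Dedekind's criterion *)

Lemma tofrac_div (D : idomainType) (x : {fraction D}) :
  exists n d : D, d != 0 /\ x = tofrac n / tofrac d.
Proof.
elim/quotW: x => x; exists (frac x).1, (frac x).2; split;
  first exact: denom_ratioP.
apply: (@mulIf _ (tofrac (frac x).2)); first by rewrite tofrac_eq0 denom_ratioP.
rewrite divfK ?tofrac_eq0 ?denom_ratioP //.
unlock tofrac; rewrite -[LHS]FracField.pi_mul; apply/eqmodP => /=.
rewrite FracField.equivfE /FracField.mulf !numden_Ratio ?oner_eq0 ?mulf_neq0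
  ?denom_ratioP //;
by rewrite ?oner_eq0 // !mulr1 mulrC.
Qed.

(** * Polynomials modulo [p] *)

Section PolyReduction.
Variables (p : nat) (p_pr : prime p).
Local Notation Zp := (padic_int p_pr).
Local Notation P := (p%:R : {poly Zp}).

Definition redp : {poly Zp} -> {poly 'F_p} := map_poly (@red p p_pr).
HB.instance Definition _ := GRing.RMorphism.copy redp (map_poly (@red p p_pr)).

(** Only a section of [redp], not a morphism: an identity modulo [p] lifts up to a multiple of [P],
    which [redp_eq] supplies. *)
Definition liftp (g : {poly 'F_p}) : {poly Zp} := map_poly (padic_lift p_pr) g.

Lemma liftpK : cancel liftp redp.
Proof.
move=> g; apply/polyP => i.
rewrite /redp coef_map /= coef_map_id0 ?padic_lift0 //; exact: red_padic_lift.
Qed.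

Lemma redp_P : redp P = 0.
Proof. by rewrite rmorph_nat -polyC_natr pchar_Fp_0. Qed.

Lemma redp_eq0 g : redp g = 0 -> exists g', g = P * g'.
Proof.
move=> rg.
have /choice [y yP] i : exists z, g`_i = p%:R * z.
  by apply: red_eq0; rewrite -coef_map -/(redp g) rg coef0.
exists (\poly_(i < size g) y i); apply/polyP => i.
rewrite -polyC_natr coefCM coef_poly; case: ltnP => [_|si]; first exact: yP.
by rewrite nth_default // mulr0.
Qed.

Lemma redp_eq g h : redp g = redp h -> exists e, g = h + P * e.
Proof.
move=> e; have [e' E] : exists e', g - h = P * e'.
  by apply: redp_eq0; rewrite rmorphB /= e subrr.
by exists e'; rewrite -E addrC subrK.
Qed.

Lemma P_neq0 : P != 0.
Proof. by rewrite -polyC_natr polyC_eq0 p_neq0. Qed.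

Lemma redp_monic g : g \is monic -> redp g \is monic.
Proof. exact: monic_map. Qed.

Lemma size_redp g : g \is monic -> size (redp g) = size g.
Proof.
move=> gm; apply: size_map_poly_id0.
by rewrite (monicP gm) rmorph1 oner_eq0.
Qed.

End PolyReduction.
Arguments redp {p p_pr}.
Arguments liftp {p} p_pr.

Section DedekindCriterion.
Variables (p : nat) (p_pr : prime p).
Local Notation Zp := (padic_int p_pr).
Local Notation Qp := {fraction Zp}.
Local Notation toQp := (@tofrac Zp).
Local Notation P := (p%:R : {poly Zp}).

Variable f : {poly Zp}.
Hypothesis f_monic : f \is monic.
Hypothesis f_size : (1 < size f)%N.

Local Notation h := (map_poly toQp f).
Local Notation K := (equation_algebra f).
Local Notation O := (equation_order f).

Let toQp_inj : injective toQp.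
Proof. by move=> x y /eqP; rewrite tofrac_eq => /eqP. Qed.

Let h_monic : h \is monic. Proof. exact: monic_map. Qed.
Let size_h g : size (map_poly toQp g) = size g.
Proof. by apply: size_map_inj_poly => //; exact: tofrac0. Qed.
Let mk_h : mk_monic h = h.
Proof. by rewrite /mk_monic size_h f_size h_monic. Qed.

Definition toK (g : {poly Zp}) : K := in_qpoly h (map_poly toQp g).

Lemma toKD a b : toK (a + b) = toK a + toK b.
Proof. by rewrite /toK !rmorphD. Qed.
Lemma toKB a b : toK (a - b) = toK a - toK b.
Proof. by rewrite /toK !rmorphB. Qed.
Lemma toKM a b : toK (a * b) = toK a * toK b.
Proof. by rewrite /toK !rmorphM. Qed.
Lemma toK1 : toK 1 = 1.
Proof. by rewrite /toK !rmorph1. Qed.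
Lemma toK0 : toK 0 = 0.
Proof. by rewrite /toK !rmorph0. Qed.
Lemma toKX a n : toK (a ^+ n) = toK a ^+ n.
Proof. by rewrite /toK !rmorphXn. Qed.
Lemma toKZ c a : toK (c *: a) = toQp c *: toK a.
Proof. by rewrite /toK map_polyZ in_qpolyZ. Qed.
Lemma toK_sum I (r : seq I) (Q : pred I) (F : I -> {poly Zp}) :
  toK (\sum_(i <- r | Q i) F i) = \sum_(i <- r | Q i) toK (F i).
Proof. by rewrite /toK !rmorph_sum. Qed.

Lemma toK_f : toK f = 0.
Proof.
apply: val_inj => /=; rewrite mk_h; exact: rmodpp.
Qed.

Lemma toK_fM w : toK (f * w) = 0.
Proof. by rewrite toKM toK_f mul0r. Qed.

Lemma toK_rem g : exists r w : {poly Zp}, [/\ (size r < size f)%N, g = r + f *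
  w & toK g = toK r].
Proof.
exists (Pdiv.Ring.rmodp g f), (Pdiv.Ring.rdivp g f).
have E : g = Pdiv.Ring.rmodp g f + f * Pdiv.Ring.rdivp g f.
  by rewrite {1}(rdivp_eq f_monic g) addrC mulrC.
split=> //; first by rewrite Pdiv.Ring.ltn_rmodp monic_neq0.
by rewrite {1}E toKD toK_fM addr0.
Qed.

Lemma toK_eq0 g : toK g = 0 -> exists w, g = f * w.
Proof.
have [r [w [sr -> ->]]] := toK_rem g.
move=> /(congr1 val) /=; rewrite mk_h Pdiv.Ring.rmodp_small ?size_h //.
move=> r0; exists w.
suff -> : r = 0 by rewrite add0r.
by apply: (map_inj_poly toQp_inj (tofrac0 _)); rewrite r0 rmorph0.
Qed.

Lemma scale_nat (c : nat) (a : K) : toQp c%:R *: a = c%:R * a.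
Proof. by rewrite rmorph_nat scaler_nat mulr_natl. Qed.

Lemma toKP a : toK (P * a) = p%:R * toK a.
Proof. by rewrite toKM; congr (_ * _); rewrite /toK !rmorph_nat. Qed.

Lemma Qp_p_neq0 : toQp p%:R != 0.
Proof. by rewrite tofrac_eq0 p_neq0. Qed.

Lemma Kp_inj : injective (fun a : K => p%:R * a).
Proof.
move=> a b; rewrite -!scale_nat => /(congr1 (fun c => (toQp p%:R)^-1 *: c)).
by rewrite !scalerA mulVf ?Qp_p_neq0 // !scale1r.
Qed.

(** A denominator is a power of [p] times a unit of [Zp], so a power of [p] clears it. *)
Lemma Qp_denom (x : Qp) : exists k c, toQp (p%:R ^+ k) * x = toQp c.
Proof.
have [n [d [d0 ->]]] := tofrac_div x.
have [k [e [re dE]]] := padic_p_decomp d0.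
have [e' e'E] := padic_unit_red re.
exists k, (n * e').
have e0 : e != 0 by apply: contraNneq d0 => e0; rewrite dE e0 mulr0.
have pk0 : (p%:R : Zp) ^+ k != 0 by rewrite expf_neq0 // p_neq0.
apply: (@mulIf _ (toQp e)); first by rewrite tofrac_eq0.
rewrite -[RHS]rmorphM -mulrA e'E mulr1 dE rmorphM invfM !mulrA.
rewrite [toQp (_ ^+ _) * _]mulrC mulrK ?unitfE ?tofrac_eq0 //.
by rewrite divfK ?tofrac_eq0.
Qed.

Lemma K_denom (a : K) : exists k g, p%:R ^+ k * a = toK g.
Proof.
suff [k [g E]] : exists k g, toQp (p%:R ^+ k) *: (val a) = map_poly toQp g.
  exists k, g; rewrite /toK -E in_qpolyZ.
  have -> : in_qpoly h (val a) = a.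
    by apply: val_inj; rewrite /= Pdiv.Ring.rmodp_small // size_mk_monic.
  by rewrite -!natrX scale_nat.
elim/poly_ind: (val a) => [|b x [k [g E]]].
  by exists 0%N, 0; rewrite scaler0 rmorph0.
have [l [c F]] := Qp_denom x.
exists (k + l)%N, ((p%:R ^+ l *: g) * 'X + (p%:R ^+ k * c)%:P).
rewrite exprD tofracM scalerDr.
set g' := p%:R ^+ l *: g; set c' := p%:R ^+ k * c.
have -> : map_poly toQp (g' * 'X + c'%:P) = map_poly toQp g' * 'X + (toQp
  c')%:P.
  by rewrite rmorphD rmorphM /= map_polyX map_polyC.
have -> : toQp c' = toQp (p%:R ^+ k) * (toQp (p%:R ^+ l) * x).
  by rewrite F -tofracM.
rewrite map_polyZ /= -E; move: (toQp (p%:R ^+ k)) (toQp (p%:R ^+ l)) => y z.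
by rewrite scalerA -scalerAl scale_polyC mulrA [z * y]mulrC.
Qed.

Lemma O_iota g : O (toK g). Proof. by exists g. Qed.

Lemma is_order_equation_order : is_order O.
Proof.
split; first split.
- by rewrite -toK1; exact: O_iota.
- by move=> _ _ [a _ <-] [b _ <-]; exists (a - b) => //; exact: toKB.
- by move=> _ _ [a _ <-] [b _ <-]; exists (a * b) => //; exact: toKM.
- exists (size f), (fun i : 'I_(size f) => toK 'X^i); apply/seteqP; split.
    move=> _ [g _ <-]; have [r [w [sr _ E]]] := toK_rem g.
    exists (fun i : 'I__ => r`_i) => //; rewrite -/(toK g).
    rewrite E -[r in RHS](coefK r) poly_def (big_ord_widen _ (fun i => r`_i *:
      'X^i) (ltnW sr)).
    rewrite toK_sum [RHS]big_mkcond /=; apply: eq_bigr => i _; rewrite -toKZ.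
    by case: ltnP => // si; rewrite nth_default // scale0r toK0.
  move=> _ [c _ <-]; exists (\sum_(i < size f) c i *: 'X^i) => //.
  by rewrite -/(toK _) toK_sum; apply: eq_bigr => i _; rewrite toKZ.
- move=> a; have [k [g E]] := K_denom a.
  exists 1%N, (fun=> (toQp (p%:R ^+ k))^-1), (fun=> toK g); split=> [i|].
    exact: O_iota.
  rewrite big_ord1 -E -!natrX -scale_nat scalerA mulVf ?scale1r //.
  by rewrite natrX rmorphXn expf_neq0 // Qp_p_neq0.
Qed.

(* [alpha] is the image of [G / p]; [alpha ^ 2 = B alpha - A C] follows from  *)
(* [U G = f - p^2 C], so that [O + O alpha] is an order.                      *)
Lemma not_maximal_equation_order U A B C :
  (1 < size (redp U))%N -> f = U ^+ 2 * A + P * U * B + P ^+ 2 * C ->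
  ~ is_maximal_order O.
Proof.
move=> sU fE [[_ [m [w Ow]] Ospan] Omax].
pose G := U * A + P * B.
have Qp0 := Qp_p_neq0.
pose alpha : K := (toQp p%:R)^-1 *: toK G.
have pa : p%:R * alpha = toK G by rewrite -scale_nat scalerA mulfV // scale1r.
have a2 : alpha * alpha = toK B * alpha - toK (A * C).
  apply: Kp_inj; apply: Kp_inj => /=.
  have -> : p%:R * (p%:R * (alpha * alpha)) = toK (G * G).
    by rewrite toKM -pa; ring.
  have -> : p%:R * (p%:R * (toK B * alpha - toK (A * C))) =
            toK (P * (B * G) - P * (P * (A * C))).
    by rewrite toKB !toKP (toKM B) -pa; ring.
  apply/eqP; rewrite -subr_eq0 -toKB; apply/eqP.
  have -> : G * G - (P * (B * G) - P * (P * (A * C))) = f * A.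
    by rewrite fE /G; ring.
  exact: toK_fM.
pose S : set K := [set toK g.1 + toK g.2 * alpha | g in setT].
have OS : O `<=` S.
  move=> _ [g _ <-]; exists (g, 0) => //=.
  by rewrite toK0 mul0r addr0.
have Sorder : is_order S.
  split; first split.
  - by apply: OS; rewrite -toK1; exact: O_iota.
  - move=> _ _ [g _ <-] [k _ <-]; exists (g.1 - k.1, g.2 - k.2) => //=.
    by rewrite !toKB; ring.
  - move=> _ _ [g _ <-] [k _ <-].
    exists (g.1 * k.1 - g.2 * k.2 * (A * C),
            g.1 * k.2 + g.2 * k.1 + g.2 * k.2 * B) => //=.
    have -> : (toK g.1 + toK g.2 * alpha) * (toK k.1 + toK k.2 * alpha) =
      toK g.1 * toK k.1 + (toK g.1 * toK k.2 + toK g.2 * toK k.1) * alpha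
        + toK g.2 * toK k.2 * (alpha * alpha) by ring.
    by rewrite a2 !(toKM, toKD, toKB); ring.
  (* Generators of [S]: those of [O], followed by their products with [alpha]. *)
  - exists (m + m)%N, (fun i : 'I_(m + m) => match fintype.split i with inl j
    => w j | inr j => w j * alpha end).
    have spanO x : O x <-> exists c : 'I_m -> Zp, x = \sum_i toQp (c i) *: w i.
      by rewrite Ow; split=> [[c _ <-]|[c ->]]; [exists c|exists c].
    apply/seteqP; split.
      move=> _ [g _ <-].
      have [c1 ->] := (spanO (toK g.1)).1 (O_iota _).
      have [c2 ->] := (spanO (toK g.2)).1 (O_iota _).
      exists (fun i : 'I_(m + m) => match fintype.split i with inl j => c1 j |
        inr j => c2 j end) => //.
      rewrite big_split_ord /=; congr (_ + _).
        by apply: eq_bigr => i _; rewrite (unsplitK (inl i)).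
      rewrite mulr_suml; apply: eq_bigr => i _.
      by rewrite (unsplitK (inr i)) -scalerAl.
    move=> _ [c _ <-]; rewrite big_split_ord /=.
    have [g1 _ E1] : O (\sum_i toQp (c (lshift m i)) *: w i).
      by apply/spanO; exists (fun i => c (lshift m i)).
    have [g2 _ E2] : O (\sum_i toQp (c (rshift m i)) *: w i).
      by apply/spanO; exists (fun i => c (rshift m i)).
    exists (g1, g2) => //=; rewrite /toK E1 E2; congr (_ + _).
      by apply: eq_bigr => i _; rewrite (unsplitK (inl i)).
    rewrite mulr_suml; apply: eq_bigr => i _.
    by rewrite (unsplitK (inr i)) -scalerAl.
  - move=> x; have [k [c [v [Ov ->]]]] := Ospan x.
    by exists k, c, v; split=> // i; exact: OS.
have : S alpha by exists (0, 1) => //=; rewrite toK0 toK1 mul1r add0r.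
(* Maximality puts [alpha] in [O], so [G - P E] is a multiple [f W]. Modulo [p] this reads
   [U A = U^2 A W], and cancelling [U A] makes [redp U] a unit. *)
rewrite (Omax _ Sorder OS) => -[E _ EE].
have /toK_eq0 [W GW] : toK (G - P * E) = 0.
  by rewrite toKB toKP /toK EE pa subrr.
have : redp G = redp f * redp W.
  by rewrite -rmorphM -GW rmorphB /= rmorphM /= redp_P mul0r subr0.
have -> : redp G = redp U * redp A.
  by rewrite /G rmorphD !rmorphM /= redp_P mul0r addr0.
have fr : redp f = redp U * redp U * redp A.
  by rewrite fE !(rmorphD, rmorphM) /= redp_P !mul0r !addr0.
have : redp f != 0 by rewrite monic_neq0 // redp_monic.
rewrite fr !mulf_eq0 !negb_or -andbA => /and3P [U0 _ A0].
have -> : redp U * redp U * redp A * redp W = redp U * redp A * (redp U * redp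
  W) by ring.
rewrite -[LHS]mulr1 => /(mulfI (mulf_neq0 U0 A0)) /esym UW1.
have : redp U %| 1 by rewrite -UW1 dvdp_mulIl.
by rewrite dvdp1 => /eqP sU1; rewrite sU1 in sU.
Qed.

(** Determinant trick: multiplication by [alpha] acts on the generators [w] through a matrix over
    [Zp], and [Q] is its characteristic polynomial. *)
Lemma integral_monic (S : set K) (alpha : K) : is_order S -> S alpha ->
  exists2 Q : {poly Zp}, Q \is monic &
    (map_poly (in_alg K \o toQp) Q).[alpha] = 0.
Proof.
move=> [[S1 SB SM] [m [w Ow]] _] Sa.
have spanO x : S x <-> exists c : 'I_m -> Zp, x = \sum_i toQp (c i) *: w i.
  by rewrite Ow; split=> [[c _ <-]|[c ->]]; [exists c|exists c].
have Sw i : S (w i).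
  apply/spanO; exists (fun j => (i == j)%:R); rewrite (bigD1 i) //= eqxx.
  rewrite tofrac1 scale1r big1 ?addr0 // => j ji.
  by rewrite eq_sym (negPf ji) tofrac0 scale0r.
have /choice [M ME] i : exists c : 'I_m -> Zp, alpha * w i = \sum_j toQp (c j)
  *: w j.
  by apply/spanO; exact: SM.
pose MZ : 'M[Zp]_m := \matrix_(i, j) M i j.
pose phi : {rmorphism Zp -> K} := in_alg K \o toQp.
exists (char_poly MZ); first exact: char_poly_monic.
rewrite -/phi map_char_poly.
pose N : 'M[K]_m := alpha%:M - map_mx phi MZ.
have detE : (char_poly (map_mx phi MZ)).[alpha] = \det N.
  rewrite /char_poly -horner_evalE -det_map_mx; congr (\det _).
  apply/matrixP => i j; rewrite !mxE /= horner_evalE !hornerE.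
  by rewrite hornerMn hornerX.
rewrite detE.
pose wv : 'cV[K]_m := \col_i w i.
have Nw : N *m wv = 0.
  rewrite mulmxBl mul_scalar_mx; apply/matrixP => i j; rewrite !mxE ME.
  apply/eqP; rewrite subr_eq0; apply/eqP; apply: eq_bigr => k _.
  by rewrite !mxE /= mulr_algl.
have dw i : \det N * w i = 0.
  have : (\adj N *m N) *m wv = 0 by rewrite -mulmxA Nw mulmx0.
  rewrite mul_adj_mx mul_scalar_mx => /matrixP /(_ i 0).
  by rewrite !mxE.
(* The determinant kills every generator, and [1] is a combination of them, so it vanishes. *)
have [c E] := (spanO 1).1 S1.
rewrite -[LHS]mulr1 E mulr_sumr big1 // => i _.
by rewrite -scalerAr dw scaler0.
Qed.

(* Homogenization of a monic equation for [alpha], given [z alpha = Y].       *)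
Lemma integral_power (alpha : K) (Q z Y : {poly Zp}) : Q \is monic ->
  (map_poly (in_alg K \o toQp) Q).[alpha] = 0 -> toK z * alpha = toK Y ->
  exists m E W, Y ^+ m = z * E + f * W.
Proof.
move=> Qm Qa zY; pose m := (size Q).-1; exists m.
have sQ : size Q = m.+1 by rewrite prednK // size_poly_gt0 monic_neq0.
pose E := \sum_(i < m) (Q`_i)%:P * z ^+ (m - i.+1) * Y ^+ i.
suff : toK (Y ^+ m + z * E) = 0.
  by move=> /toK_eq0 [W WE]; exists (- E), W; rewrite -WE; ring.
rewrite -[RHS](mulr0 (toK z ^+ m)) -Qa (horner_coef_wide (n := m.+1));
  last first.
  by rewrite -sQ size_poly.
rewrite big_ord_recr /= mulrDr addrC toKD; congr (_ + _); last first.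
  rewrite coef_map /= (_ : Q`_m = 1);
    last by rewrite -(monicP Qm) /lead_coef sQ.
  by rewrite tofrac1 scale1r mul1r -exprMn zY toKX.
rewrite toKM toK_sum !mulr_sumr; apply: eq_bigr => i _.
rewrite coef_map /= mul_polyC -scalerAl toKZ toKM !toKX -zY.
rewrite mulr_algl -!scalerAr exprMn.
have -> : toK z ^+ m = toK z * toK z ^+ (m - i.+1) * toK z ^+ i.
  by rewrite -exprS -exprD subnSK ?ltn_ord // subnK // ltnW.
by congr (_ *: _); ring.
Qed.

(** Some [a] in [S] outside [O] has [p a] in [O] and [U a] in [O], with [U] irreducible modulo [p].
    Writing [p a = G] and [U a = T] gives [U G - P T = f W]. Integrality of [a] puts [G] and [T] in
    the ideal [(p, U)], hence [f W] in its square, and [W] is prime to [U] modulo [p], so [f] lies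
    there too. *)
Lemma not_maximalP (S : set K) : is_order S -> O `<=` S -> S <> O ->
  exists U A B C, [/\ irreducible_poly (redp U) &
     f = U ^+ 2 * A + P * U * B + P ^+ 2 * C].
Proof.
move=> Sord OS Sneq.
have [[S1 SB SM] _ _] := Sord.
have [[E1 EB EM] _ _] := is_order_equation_order.
have ON x : O x -> O (- x) by move=> Ox; rewrite -sub0r; apply: EB => //;
  rewrite -toK0; exact: O_iota.
have OD x y : O x -> O y -> O (x + y) by move=> Ox /ON Oy; rewrite -[y]opprK;
  exact: EB.
have [beta Sb nOb] : exists2 beta, S beta & ~ O beta.
  apply: contrapT => H; apply: Sneq; apply/seteqP; split=> // x Sx.
  by apply: contrapT => nOx; apply: H; exists x.
have S_toK g : S (toK g) by apply: OS; exact: O_iota.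
have toKp : toK P = p%:R by rewrite -[P]mulr1 toKP toK1 mulr1.
have [a0 [Sa0 nOa0 Opa0]] : exists a, [/\ S a, ~ O a & O (p%:R * a)].
  have [k [g]] := K_denom beta.
  (* The element sought is the last multiple of [beta] by a power of [p] that is still outside
     [O]. *)
  elim: k beta Sb nOb => [|k IH] b Sb nOb bE.
    by case: nOb; rewrite -[b]mul1r -(expr0 p%:R) bE; exact: O_iota.
  have [Opb|nOpb] := pselect (O (p%:R * b)); first by exists b.
  apply: (IH (p%:R * b)) => //; last by rewrite mulrA -exprSr.
  by apply: SM => //; rewrite -toKp.
(* The size of [v] is minimized over all pairs [(a, v)], not for a fixed [a]; this is what makes the
   minimal [v] irreducible. *)
pose good d := exists a (v : {poly 'F_p}), [/\ S a, ~ O a, O (p%:R * a),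
  O (toK (liftp p_pr v) * a) & v != 0 /\ size v = d].
have ideal a g e : O (p%:R * a) -> redp g = redp e -> O (toK e * a) -> O (toK g
  * a).
  move=> Opa /redp_eq [k ->] Oe; rewrite toKD toKP mulrDl; apply: OD => //.
  by rewrite mulrAC mulrC; apply: EM => //; exact: O_iota.
have ex : exists d, `[< good d >].
  (* [f] vanishes in [K], so its reduction is an admissible [v]. *)
  exists (size (redp f)); apply/asboolP; exists a0, (redp f); split=> //.
    apply: (ideal _ _ f) => //; first by rewrite liftpK.
    by rewrite toK_f mul0r -toK0; exact: O_iota.
  by split=> //; rewrite monic_neq0 // redp_monic.
case: (ex_minnP ex) => d /asboolP [a [v [Sa nOa Opa Ova [v0 sv]]]] dmin.
have vmin a' v' : S a' -> ~ O a' -> O (p%:R * a') -> O (toK (liftp p_pr v') *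
  a') ->
    v' != 0 -> (size v <= size v')%N.
  by move=> *; rewrite sv; apply: dmin; apply/asboolP; exists a', v'.
have v_irr : irreducible_poly v.
  split.
    rewrite ltnNge; apply/negP => /size1_polyC vC.
    have c0 : v`_0 != 0 by apply: contraNneq v0 => c0; rewrite vC c0.
    apply: nOa; rewrite -[a]mul1r -toK1.
    apply: (ideal _ _ (liftp p_pr ((v`_0)^-1)%:P * liftp p_pr v)) => //.
      by rewrite rmorphM /= !liftpK {2}vC -polyCM mulVf // rmorph1.
    by rewrite toKM -mulrA; apply: EM => //; exact: O_iota.
  (* For a proper factorization [v = q2 q], either [q a] is in [O] and the pair [(a, q)] is smaller,
     or [q a] is outside [O] and the pair [(q a, q2)] is smaller. *)
  move=> q sq1 qv; rewrite -dvdp_size_eqp // eqn_leq dvdp_leq //= leqNgt.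
  apply/negP => sqv.
  have /dvdpP [q2 vE] := qv.
  have [q20 q0] : q2 != 0 /\ q != 0.
    by move: v0; rewrite vE mulf_eq0 negb_or => /andP.
  have [Oq|nOq] := pselect (O (toK (liftp p_pr q) * a)).
    by move: sqv; rewrite ltnNge (vmin a q).
  have : (size v <= size q2)%N.
    apply: (vmin (toK (liftp p_pr q) * a)) => //.
    - exact: SM.
    - by rewrite mulrCA; apply: EM => //; exact: O_iota.
    - rewrite mulrA -toKM; apply: (ideal _ _ (liftp p_pr v)) => //.
      by rewrite rmorphM /= !liftpK.
  rewrite vE size_mul //.
  move: sq1 q0; rewrite -size_poly_gt0; case: (size q) => [|[|s]] // _ _.
  by rewrite addnS /= addnS ltnNge leq_addr.
have sv1 : (1 < size v)%N by case: v_irr.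
pose U := liftp p_pr v.
have rU : redp U = v by exact: liftpK.
have [T _ TE] := Ova; rewrite -/U -/(toK T) in TE.
have [G sG GE] : exists2 G : {poly Zp}, (size G < size f)%N & p%:R * a = toK G.
  case: Opa => G _ <-; have [r [w [sr _ E]]] := toK_rem G.
  by exists r.
have [W WE] : exists W, U * G - P * T = f * W.
  apply: toK_eq0; rewrite toKB toKM toKP -GE TE.
  by rewrite mulrCA subrr.
have rW : v * redp G = redp f * redp W.
  by rewrite -rmorphM -WE rmorphB !rmorphM /= rU redp_P mul0r subr0.
have rf0 : redp f != 0 by rewrite monic_neq0 // redp_monic.
have G0 : redp G != 0.
  apply/eqP => /redp_eq0 [G' G'E]; apply: nOa.
  suff -> : a = toK G' by exact: O_iota.
  by apply: Kp_inj => /=; rewrite GE G'E toKP.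
have W0 : redp W != 0.
  apply/eqP => W0; move/eqP: rW; rewrite W0 mulr0 mulf_eq0.
  by rewrite (negPf v0) (negPf G0).
(* Modulo [p] one has [v G = f W] with [G] of smaller size than [f]; if [v] divided [W], the right
   side would have the larger degree. *)
have cop : coprimep v (redp W).
  rewrite irreducible_poly_coprime //; apply/negP => /(dvdp_leq W0).
  move/(congr1 (fun q : {poly _} => size q)): rW;
    rewrite !size_mul // (size_redp f_monic).
  have sG' : (size (redp G) < size f)%N by exact: leq_ltn_trans (size_poly _ _)
    sG.
  move=> sW sle.
  have sG1 : (0 < size (redp G))%N by rewrite size_poly_gt0.
  have sW1 : (0 < size (redp W))%N by rewrite size_poly_gt0.
  move: sW sle sG' sG1 sW1.
  by move: (size v) (size (redp G)) (size f) (size (redp W)) => x y s t; lia.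
have vf : v %| redp f.
  by rewrite -(Gauss_dvdpl _ cop) -rW dvdp_mulIl.
have [Q Qm Qa] := integral_monic Sord Sa.
(* The homogenized integral equation of [a] makes [v] divide a power of [Y] modulo [p]. It is
   applied to [p a = G] and to [U a = T]. *)
have vroot z Y : v %| redp z -> toK z * a = toK Y -> v %| redp Y.
  move=> vz zY; have [m [E [W' YE]]] := integral_power Qm Qa zY.
  have : v %| redp Y ^+ m.
    by rewrite -rmorphXn YE rmorphD !rmorphM /= dvdp_add // dvdp_mulr.
  elim: m {YE} => [|m IH]; first by rewrite expr0 dvdp1 => /eqP sv';
    rewrite sv' in sv1.
  rewrite exprS; have [//|nvY] := boolP (v %| redp Y).
  by rewrite Gauss_dvdpr ?irreducible_poly_coprime // => /IH;
    rewrite (negPf nvY).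
have lin Y : v %| redp Y -> exists Y1 Y2, Y = U * Y1 + P * Y2.
  move=> /dvdpP [q qE].
  have [e ->] : exists e, Y = U * liftp p_pr q + P * e.
    by apply: redp_eq; rewrite rmorphM /= rU liftpK qE mulrC.
  by exists (liftp p_pr q), e.
have [G1 [G2 G12]] : exists Y1 Y2, G = U * Y1 + P * Y2.
  by apply/lin/(vroot P); rewrite ?redp_P ?dvdp0 // toKp.
have [T1 [T2 T12]] : exists Y1 Y2, T = U * Y1 + P * Y2.
  by apply/lin/(vroot U); rewrite ?rU ?TE.
have [F1 [F2 F12]] := lin _ vf.
have /Bezout_eq1_coprimepP [[b1 b2] /= bE] := cop.
have [C CE] : exists C, 1 = liftp p_pr b2 * W + liftp p_pr b1 * U + P * C.
  apply: redp_eq; rewrite rmorph1 rmorphD !rmorphM /= !liftpK ?rU -bE.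
  by rewrite addrC.
(* The witnesses come from multiplying the lifted Bezout identity [1 = b2 W + b1 U + P C] by [f],
   with [f W = U G - P T] in the first term and [f = U F1 + P F2] in the other two. *)
exists U, (liftp p_pr b2 * G1 + liftp p_pr b1 * F1),
  (liftp p_pr b2 * (G2 - T1) + liftp p_pr b1 * F2 + C * F1),
  (C * F2 - liftp p_pr b2 * T2).
split; first by rewrite rU.
rewrite -[LHS]mul1r {1}CE.
have -> : (liftp p_pr b2 * W + liftp p_pr b1 * U + P * C) * f =
  liftp p_pr b2 * (f * W) + liftp p_pr b1 * U * f + P * C * f by ring.
rewrite -WE; rewrite {1 2}F12 G12 T12; ring.
Qed.

(** The identity on the right says that [f] lies in the square of the ideal [(p, U)]. *)
Lemma maximal_equation_orderP :
  is_maximal_order O <->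
  ~ exists U A B C, [/\ irreducible_poly (redp U) &
     f = U ^+ 2 * A + P * U * B + P ^+ 2 * C].
Proof.
split=> [Omax [U [A [B [C [[sU _] fE]]]]]|nU].
  exact: not_maximal_equation_order sU fE Omax.
split=> [|S Sord OS]; first exact: is_order_equation_order.
by apply: contrapT => Sneq; apply: nU; exact: not_maximalP Sord OS Sneq.
Qed.

End DedekindCriterion.

(** * Monic irreducible polynomials over a finite field *)

Lemma prod_1B (R : comNzRingType) (I : finType) (T : {set I}) (g : I -> R) :
  \prod_(i in T) (1 - g i) =
  \sum_(J : {set I} | J \subset T) (-1) ^+ #|J| * \prod_(i in J) g i.
Proof.
(* The product is extended to all of [I] so that distributivity applies; a subset not contained in
   [T] picks up a factor 0. *)
transitivity (\prod_i ((if i \in T then - g i else 0) + 1)).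
  rewrite big_mkcond; apply: eq_bigr => i _.
  by case: (i \in T); rewrite ?add0r // addrC.
rewrite bigA_distr (bigID (fun J : {set I} => J \subset T)) /= [X in _ + X]big1
  ?addr0.
  apply: eq_bigr => J JT.
  rewrite -big_mkcond /= (eq_bigr (fun i => - g i)); last first.
    by move=> i iJ; rewrite (fintype.subsetP JT).
  by rewrite prodrN.
move=> J /fintype.subsetPn [i iJ iT];
  rewrite (bigD1 i) //= iJ (negPf iT) mul0r //.
Qed.

Section MonicIrreducible.
Variable F : finFieldType.
Implicit Types v w z : {poly F}.

Definition mirr (u : {poly F}) := (u \is monic) && irreducibleb u.

Lemma mirr_monic u : mirr u -> u \is monic.
Proof. by case/andP. Qed.

Lemma mirr_irr u : mirr u -> irreducible_poly u.
Proof. by case/andP => _ /irreducibleP. Qed.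

Lemma mirr_size u : mirr u -> (1 < size u)%N.
Proof. by case/mirr_irr. Qed.

Lemma mirr_neq0 u : mirr u -> u != 0.
Proof. by move/mirr_monic/monic_neq0. Qed.

Lemma mirr_coprime u w : mirr u -> coprimep u w = ~~ (u %| w).
Proof. by move/mirr_irr/irreducible_poly_coprime. Qed.

Lemma mirr_dvdM u w z : mirr u -> (u %| w * z) = (u %| w) || (u %| z).
Proof.
move=> mu; have [uw|nuw] := boolP (u %| w); first by rewrite dvdp_mulr.
by rewrite Gauss_dvdpr // mirr_coprime.
Qed.

Lemma mirr_dvdX u w n : mirr u -> u %| w ^+ n -> u %| w.
Proof.
move=> mu; elim: n => [|n IH].
  by rewrite expr0 dvdp1 => /eqP s1; have := mirr_size mu; rewrite s1.
by rewrite exprS mirr_dvdM // => /orP [].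
Qed.

Lemma mirr_dvd_eq u v : mirr u -> mirr v -> u %| v -> u = v.
Proof.
move=> mu mv uv; apply/eqP; rewrite -eqp_monic ?mirr_monic //.
case: (mirr_irr mv) => _; apply=> //.
by have := mirr_size mu; case: (size u) => [|[]].
Qed.

Lemma mirr_neq_coprime u v : mirr u -> mirr v -> u != v -> coprimep u v.
Proof.
by move=> mu mv; rewrite mirr_coprime //;
  apply: contra => /(mirr_dvd_eq mu mv) ->.
Qed.

Lemma mirr_X : mirr 'X.
Proof.
rewrite /mirr monicX; apply/irreducibleP.
by have := irredp_XsubC (0 : F); rewrite subr0.
Qed.

Lemma mirr_XsubC a : mirr ('X - a%:P).
Proof. by rewrite /mirr monicXsubC; apply/irreducibleP/irredp_XsubC. Qed.

Lemma mirr_scale z : irreducible_poly z -> mirr ((lead_coef z)^-1 *: z).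
Proof.
move=> [sz zi]; have z0 : lead_coef z != 0.
  by rewrite lead_coef_eq0 -size_poly_gt0 ltnW.
have z1 : (lead_coef z)^-1 != 0 by rewrite invr_eq0.
apply/andP; split; first by rewrite monicE lead_coefZ mulVf.
apply/irreducibleP; split; first by rewrite size_scale.
move=> q sq qz; have e := eqp_scale z z1.
rewrite (eqp_trans (zi q sq _)) 1?eqp_sym //.
by rewrite -(eqp_dvdr _ e).
Qed.

Lemma exists_mirr z : (1 < size z)%N -> exists2 u, mirr u & u %| z.
Proof.
elim: {z}(size z) {-2}z (leqnn (size z)) => [|m IH] z sz s1.
  by move: s1; rewrite ltnNge (leq_trans sz).
have [/irreducibleP zi|] := boolP (irreducibleb z).
  exists ((lead_coef z)^-1 *: z); first exact: mirr_scale.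
  by rewrite dvdpZl ?dvdpp // invr_eq0 lead_coef_eq0 -size_poly_gt0 ltnW.
rewrite /irreducibleb s1 /= negb_forall => /existsP [q].
rewrite negb_imply -ltnNge -dvdpE => /andP [qz sq].
have [|u mu uq] := IH q _ sq; last by exists u => //; exact: dvdp_trans qz.
by rewrite (leq_trans (size_npoly q)) // -ltnS prednK // ltnW.
Qed.

Lemma mirr_notin_coprime u (s : seq {poly F}) : mirr u -> all mirr s ->
  u \notin s -> coprimep u (\prod_(v <- s) v).
Proof.
move=> mu; elim: s => [|v s IH] /=; first by rewrite big_nil coprimep1.
case/andP => mv ms; rewrite inE negb_or => /andP [uv us].
by rewrite big_cons coprimepMr IH // andbT mirr_neq_coprime.
Qed.

(** Distinct monic irreducible polynomials are coprime, and so are their powers. *)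
Lemma dvdp_prod_mirr k (s : seq {poly F}) w : uniq s -> all mirr s ->
  ((\prod_(u <- s) u) ^+ k %| w) = all (fun u => u ^+ k %| w) s.
Proof.
elim: s => [|u s IH] /=; first by rewrite big_nil expr1n dvd1p.
case/andP => us un /andP [mu ms].
rewrite big_cons exprMn Gauss_dvdp ?IH //.
by rewrite coprimep_expl // coprimep_expr // mirr_notin_coprime.
Qed.

Section BoundedSize.
Variable N : nat.
Implicit Types J T : {set {poly_N F}}.

(** A squarefree monic polynomial is encoded by the set [J] of its monic irreducible factors, so
    that its Moebius value is [(-1) ^+ #|J|]. Bounding the sizes by [N] keeps the type of these sets
    finite. *)
Definition setprod J : {poly F} := \prod_(u in J) polyn u.

Lemma setprodE J : setprod J = \prod_(u <- map (@polyn F N) (enum J)) u.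
Proof. by rewrite big_map big_enum. Qed.

Lemma dvdp_setprodX k J w : (forall u, u \in J -> mirr (polyn u)) ->
  (setprod J ^+ k %| w) = [forall u in J, polyn u ^+ k %| w].
Proof.
move=> mJ; rewrite setprodE dvdp_prod_mirr.
- apply/allP/forall_inP => [H u uJ|H _ /mapP [u uJ ->]].
    by apply: H; apply: map_f; rewrite mem_enum.
  by apply: H; rewrite mem_enum in uJ.
- by rewrite map_inj_uniq ?enum_uniq //; exact: val_inj.
- by apply/allP => _ /mapP [u uJ ->]; apply: mJ; rewrite mem_enum in uJ.
Qed.

Lemma dvdp_setprod J w : (forall u, u \in J -> mirr (polyn u)) ->
  (setprod J %| w) = [forall u in J, polyn u %| w].
Proof. exact: (@dvdp_setprodX 1). Qed.

Lemma coprimep_setprod J w : (forall u, u \in J -> mirr (polyn u)) ->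
  coprimep (setprod J) w = [forall u in J, ~~ (polyn u %| w)].
Proof.
move=> mJ; apply/idP/forall_inP => [cop u uJ|H].
  rewrite -mirr_coprime ?mJ //; apply: coprimep_dvdr cop.
  by rewrite /setprod (bigD1 u) //= dvdp_mulIl.
rewrite /setprod; apply: (big_ind (fun v => coprimep v w)) => [|x y cx cy|u uJ].
- exact: coprime1p.
- by rewrite coprimepMl cx.
- by rewrite mirr_coprime ?mJ // H.
Qed.

Lemma monic_setprod J : (forall u, u \in J -> mirr (polyn u)) -> setprod J \is
  monic.
Proof. by move=> mJ; apply: monic_prod => u uJ; exact/mirr_monic/mJ. Qed.

End BoundedSize.

(** The solutions are [b = v c + r], with [r] the remainder of [- h] modulo [v] and [c] free of
    degree less than [n - deg v]. *)
Lemma card_residue n v h : v != 0 -> (size v <= n.+1)%N ->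
  #|[pred b : {poly_n F} | v %| h + polyn b]| = (#|F| ^ (n - (size v).-1))%N.
Proof.
move=> v0 sv; have sv0 : (0 < size v)%N by rewrite size_poly_gt0.
pose r := (- h) %% v.
have sr : (size r < size v)%N by rewrite ltn_modp.
pose phi (c : {poly_(n - (size v).-1) F}) : {poly_n F} := npolyp n (v * polyn c
  + r).
have phiE c : polyn (phi c) = v * polyn c + r.
  rewrite npolypK // (leq_trans (size_polyD _ _)) // geq_max; apply/andP; split.
    have := size_npoly c; have := size_mul_leq v (polyn c); lia.
  by rewrite -ltnS (leq_trans sr).
have phi_inj : injective phi.
  move=> c c' /(congr1 (@polyn _ _)); rewrite !phiE => /addIr /(mulfI v0).
  exact: val_inj.
rewrite -card_npoly -(card_imset predT phi_inj); apply: eq_card => b.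
rewrite inE; apply/idP/imsetP => [vb|[c _ ->]]; last first.
  rewrite phiE addrCA dvdp_addr ?dvdp_mulIl //.
  by rewrite /r modpN {1}(divp_eq h v) addrK dvdp_mulIr.
have br : polyn b %% v = r.
  by apply/eqP; rewrite -subr_eq0 /r -modpN -modpD opprK addrC; exact: vb.
exists (npolyp _ (polyn b %/ v)) => //; apply: val_inj.
rewrite /= phiE npolypK; last by rewrite size_divp // leq_sub2r // size_npoly.
by rewrite mulrC -br -divp_eq.
Qed.

(** * Densities of residue classes *)

Section Weights.
Variable R : numFieldType.
Local Notation q := (#|F|%:R : R).

Lemma q_neq0 : q != 0.
Proof. by rewrite pnatr_eq0 -lt0n; apply/card_gt0P; exists 0. Qed.

(** The inverse norm [q^(- deg z)] of a nonzero [z], which is the density of its multiples. *)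
Definition wt z : R := q^-1 ^+ (size z).-1.

Lemma wt_setprod N (J : {set {poly_N F}}) : (forall u, u \in J -> mirr (polyn
  u)) ->
  wt (setprod J) = \prod_(u in J) wt (polyn u).
Proof.
move=> mJ; suff [] : wt (setprod J) = \prod_(u in J) wt (polyn u) /\ setprod J
  != 0 by [].
rewrite /setprod; apply: (big_ind2 (fun z (x : R) => wt z = x /\ z != 0)).
- by rewrite /wt size_poly1 expr0 oner_neq0.
- move=> z1 x1 z2 x2 [<- z10] [<- z20]; split; last by rewrite mulf_neq0.
  rewrite /wt -exprD size_mul //; congr (_ ^+ _).
  move: z10 z20; rewrite -!size_poly_gt0.
  by case: (size z1) => // a; case: (size z2) => // b _ _; rewrite addSn addnS.
- by move=> u uJ; split=> //; exact/mirr_neq0/mJ.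
Qed.

Lemma natr_card_residue n v h : v != 0 -> (size v <= n.+1)%N ->
  #|[pred b : {poly_n F} | v %| h + polyn b]|%:R = q ^+ n * wt v.
Proof.
move=> v0 sv; rewrite card_residue // natrX /wt exprVn expfB_cond //.
  by rewrite (negPf q_neq0); have := size_poly_gt0 v; rewrite v0; lia.
Qed.

(** Inclusion-exclusion over the subsets [J] of [T]. The size hypothesis bounds the degree of every
    [setprod J] by [n], so that each count of multiples is exact. *)
Lemma card_coprime_setprod n N (T : {set {poly_N F}}) h :
  (forall u, u \in T -> mirr (polyn u)) -> (size (setprod T) <= n.+1)%N ->
  #|[pred b : {poly_n F} | coprimep (setprod T) (h + polyn b)]|%:R =
  q ^+ n * \prod_(u in T) (1 - wt (polyn u)).
Proof.
move=> mT sT; rewrite prod_1B mulr_sumr -sum1_card natr_sum big_mkcond /=.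
transitivity (\sum_(b : {poly_n F}) \sum_(J : {set {poly_N F}} | J \subset T)
    ((-1) ^+ #|J| * (setprod J %| h + polyn b)%R%:R : R)).
  apply: eq_bigr => b _.
  transitivity (\prod_(u in T) (1 - (polyn u %| h + polyn b)%R%:R) : R).
    rewrite inE coprimep_setprod //; case: ifPn => [/forall_inP H|].
      by rewrite big1 // => u uT; rewrite (negPf (H u uT)) subr0.
    rewrite negb_forall_in => /exists_inP [u uT]; rewrite negbK => uh.
    by rewrite (bigD1 u) //= uh subrr mul0r.
  rewrite prod_1B; apply: eq_bigr => J JT; congr (_ * _).
  rewrite dvdp_setprod; last by move=> u /(fintype.subsetP JT); exact: mT.
  case: forall_inP => [H|].
    by rewrite big1 // => u uJ; rewrite H.
  move/forall_inP; rewrite negb_forall_in => /exists_inP [u uJ uh].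
  by rewrite (bigD1 u) //= (negPf uh) mul0r.
rewrite exchange_big /=; apply: eq_bigr => J JT.
have mJ u : u \in J -> mirr (polyn u) by move/(fintype.subsetP JT); exact: mT.
rewrite -wt_setprod // -mulr_sumr mulrCA; congr (_ * _).
rewrite -(natr_card_residue h); first 1 last.
- exact/monic_neq0/monic_setprod.
- apply: leq_trans sT; apply: dvdp_leq; first exact/monic_neq0/monic_setprod.
  rewrite dvdp_setprod //; apply/forall_inP => u uJ.
  by rewrite /setprod (bigD1 u) ?(fintype.subsetP JT) //= dvdp_mulIl.
rewrite -sum1_card natr_sum [RHS]big_mkcond /=; apply: eq_bigr => b _.
by rewrite inE; case: (_ %| _).
Qed.

End Weights.

(** * Sums of the Moebius function over polynomials prime to [x] *)

Section MoebiusSum.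
Variable N : nat.
Local Notation q := (#|F|%:R : int).

(** These sets encode the squarefree monic polynomials prime to [x], the only ones that can divide a
    polynomial with nonzero constant term. *)
Definition no_X (J : {set {poly_N F}}) :=
  [forall u in J, mirr (polyn u) && (polyn u != 'X)].

Lemma no_X_mirr J : no_X J -> forall u, u \in J -> mirr (polyn u).
Proof. by move/forall_inP => H u /H /andP []. Qed.

(** The sum of [mu(v) q^(d - deg v)] over the squarefree monic [v] prime to [x] with
    [deg v <= d]. *)
Let D d : int := \sum_(J | no_X J && (size (setprod J) <= d.+1)%N)
  (-1) ^+ #|J| * q ^+ (d.+1 - size (setprod J)).

(** The polynomials ['X^d + b] run over all monic polynomials of degree [d]. *)
Let cnt v d : int := #|[pred b : {poly_d F} | v %| 'X^d + polyn b]|%:R.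

Let cntE v d : v \is monic ->
  cnt v d = if (size v <= d.+1)%N then q ^+ (d.+1 - size v) else 0.
Proof.
move=> vm; have v0 := monic_neq0 vm; rewrite /cnt; case: leqP => sv.
  rewrite card_residue // natrX; congr (_ ^+ _).
  by move: v0; rewrite -size_poly_gt0; lia.
rewrite eq_card0 // => b; rewrite inE; apply/negP.
have sz : size ('X^d + polyn b) = d.+1.
  by rewrite size_polyDl size_polyXn // ltnS size_npoly.
move/dvdp_leq; rewrite -size_poly_gt0 sz => /(_ isT).
by rewrite leqNgt sv.
Qed.

(** The term of [v] in the difference counts the monic multiples of [v] of degree [d + 1] that are
    prime to [x]. Exchanging the sums leaves, for each monic [z] of degree [d + 1] prime to [x], the
    sum of [mu(v)] over [v] dividing [z], which is 0 as [z] is not constant. *)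
Let D_rec d : (d.+1 < N)%N -> D d.+1 = D d.
Proof.
move=> dN; apply/eqP; rewrite -subr_eq0; apply/eqP.
transitivity (\sum_(J | no_X J)
   (-1) ^+ #|J| * (cnt (setprod J) d.+1 - cnt ('X * setprod J) d.+1)).
  rewrite /D !big_mkcondr -sumrB; apply: eq_bigr => J nJ.
  have mJ : setprod J \is monic by exact/monic_setprod/no_X_mirr.
  rewrite !cntE ?monicMr ?monicX // ['X * _]mulrC size_mulX ?monic_neq0 //.
  rewrite ltnS subSS mulrBr; congr (_ - _); first by case: ifP; rewrite ?mulr0.
  by case: ifP; rewrite ?mulr0.
pose S z : {set {poly_N F}} := finset (fun u : {poly_N F} => mirr (polyn u) &&
  (polyn u %| z)).
transitivity (\sum_(b : {poly_d.+1 F} | ~~ ('X %| 'X^(d.+1) + polyn b))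
   \prod_(u in S ('X^(d.+1) + polyn b)) (1 - 1 : int)); last first.
  apply: big1 => b Xb.
  have sz : size ('X^(d.+1) + polyn b) = d.+2.
    by rewrite size_polyDl size_polyXn // ltnS size_npoly.
  have [|u mu uz] := @exists_mirr ('X^(d.+1) + polyn b); first by rewrite sz.
  (* The hypothesis on [N] guarantees that the irreducible factors of [z] fit into [{poly_N F}]. *)
  have su : (size u <= N)%N.
    apply: (leq_trans _ dN); rewrite -sz dvdp_leq // -size_poly_gt0 sz //.
  rewrite (bigD1 (npolyp N u)) /= ?subrr ?mul0r // inE npolypK //.
  by rewrite mu.
under [RHS]eq_bigr => b Xb do rewrite prod_1B.
rewrite [RHS](exchange_big_dep no_X) /=; last first.
  move=> b J Xb /fintype.subsetP JS; apply/forall_inP => u /JS;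
    rewrite inE => /andP [-> uz].
  by apply: contraNneq Xb => uX; rewrite uX in uz.
apply: eq_bigr => J nJ; have mJ := no_X_mirr nJ.
under [RHS]eq_bigr => b _ do rewrite big1_eq.
rewrite -mulr_sumr; congr (_ * _).
have cntS v : cnt v d.+1 = \sum_(b : {poly_d.+1 F}) (v %| 'X^(d.+1) + polyn
  b)%R%:R.
  rewrite /cnt -sum1_card natr_sum big_mkcond /=; apply: eq_bigr => b _.
  by rewrite inE; case: (_ %| _).
rewrite !cntS -sumrB [RHS]big_mkcond /= [RHS]big_mkcond /=;
  apply: eq_bigr => b _.
have -> : (J \subset S ('X^(d.+1) + polyn b)) = (setprod J %| 'X^(d.+1) + polyn
  b).
  rewrite dvdp_setprod //; apply/fintype.subsetP/forall_inP => H u uJ.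
    by have := H u uJ; rewrite inE => /andP [].
  by rewrite inE mJ // H.
rewrite Gauss_dvdp; last first.
  rewrite coprimep_sym coprimep_setprod //; apply/forall_inP => u uJ.
  apply/negP => /(mirr_dvd_eq (mJ u uJ) mirr_X) uX.
  by move/forall_inP: nJ => /(_ u uJ); rewrite uX eqxx andbF.
by case: ('X %| _); case: (setprod J %| _).
Qed.

(** By [D_rec] all the [D e] equal [D 0 = 1], and the sum in degree [d] is [D d - q D (d - 1)]. *)
Lemma moebius_sum d : (0 < d < N)%N ->
  \sum_(J | no_X J && (size (setprod J) == d.+1)) (-1) ^+ #|J| = 1 - q :> int.
Proof.
case: d => // d /= dN.
have D1 e : (e < N)%N -> D e = 1.
  elim: e => [|e IH] eN; last by rewrite D_rec // IH // ltnW.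
  rewrite /D (big_pred1 finset.set0) => [|J].
    by rewrite cards0 /setprod big_set0 size_poly1.
  apply/andP/eqP => [[nJ sJ]|->]; last first.
    rewrite /setprod big_set0 size_poly1; split=> //.
    by apply/forall_inP => u; rewrite inE.
  apply/eqP; rewrite -finset.subset0; apply/fintype.subsetP => u uJ.
  have := mirr_size (no_X_mirr nJ uJ).
  rewrite ltnNge (leq_trans _ sJ) // dvdp_leq //.
    exact/monic_neq0/monic_setprod/no_X_mirr.
  by rewrite /setprod (bigD1 u) //= dvdp_mulIl.
transitivity (D d.+1 - q * D d); last by rewrite !D1 ?mulr1 // ltnW.
rewrite /D mulr_sumr !big_mkcondr -sumrB; apply: eq_bigr => J nJ.
rewrite mulrCA -exprS.
have -> : (size (setprod J) <= d.+2)%N = (size (setprod J) <= d.+1)%N || (size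
  (setprod J) == d.+2).
  by rewrite leq_eqVlt orbC ltnS.
have [sJ|sJ] := leqP (size (setprod J)) d.+1; last first.
  by case: eqP => [->|_] /=; rewrite ?subnn ?expr0 ?mulr1 subr0.
by rewrite subSn // subrr; case: eqP sJ => // ->; rewrite ltnn.
Qed.

End MoebiusSum.
End MonicIrreducible.

(** * Haar measure of sets defined modulo p^2 *)

Lemma probability_equal_fibres (R : realType) (d : measure_display)
    (X : measurableType d) (mu : probability X R) (I : finType) (dig : X -> I) :
  (forall i, measurable [set x | dig x = i]) ->
  (forall i j, mu [set x | dig x = i] = mu [set x | dig x = j]) ->
  forall Q : pred I, fine (mu [set x | Q (dig x)]) = #|Q|%:R / #|I|%:R.
Proof.
move=> mfib eqfib.
have [m mE] : exists m : R, forall i, mu [set x | dig x = i] = m%:E.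
  (* The value 0 is a placeholder for an empty [I], a case excluded below by the total mass 1. *)
  have [i0 _|I0] := pickP (@predT I); last by exists 0 => i; have := I0 i.
  exists (fine (mu [set x | dig x = i0])) => i.
  by rewrite fineK ?(eqfib i i0) // fin_num_measure.
have seqE (s : seq I) : uniq s ->
    measurable [set x | dig x \in s] /\ mu [set x | dig x \in s] = (m *+ size
      s)%:E.
  elim: s => [_|i s IH /= /andP [si us]].
    rewrite (_ : [set x | _] = set0); first by rewrite measure0 mulr0n.
    by apply/seteqP; split=> x.
  have [ms muE] := IH us.
  have -> : [set x | dig x \in i :: s] = [set x | dig x = i] `|` [set x | dig x
    \in s].
    apply/seteqP; split=> x /=; rewrite inE.
      by case/orP => [/eqP|]; [left|right].
    by case=> [->|->]; rewrite ?eqxx ?orbT.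
  split; first exact: measurableU.
  rewrite measureU //; last first.
    by apply/seteqP; split=> x //= [-> xs]; rewrite xs in si.
  by rewrite mulrS EFinD; congr (_ + _)%E; [exact: mE|exact: muE].
have QE (Q : pred I) : mu [set x | Q (dig x)] = (m *+ #|Q|)%:E.
  rewrite cardE -(seqE _ (enum_uniq Q)).2; congr (mu _).
  by apply/seteqP; split=> x /=; rewrite mem_enum.
have m1 : m *+ #|I| = 1.
  have := QE predT; rewrite (_ : [set x | _] = setT); last by apply/seteqP;
    split.
  by rewrite probability_setT => -[].
have I0 : #|I|%:R != 0 :> R.
  apply/eqP => I0; move/eqP: m1; rewrite -mulr_natr I0 mulr0 eq_sym.
  by rewrite oner_eq0.
move=> Q; rewrite QE /= mulr_natl; congr (_ *+ _).
by apply: (mulIf I0); rewrite mulVf // mulr_natr.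
Qed.

Lemma rVpoly_sum (A : nzRingType) n (c : 'rV[A]_n) :
  \sum_(i < n) c 0 i *: 'X^i = rVpoly c.
Proof.
rewrite /rVpoly poly_def; apply: eq_bigr => i _.
by rewrite valK.
Qed.

(** * The first two [p]-adic digits, and [Pmax] as a finite average *)

Section Digits.
Variables (p : nat) (p_pr : prime p) (n : nat).
Local Notation Zp := (padic_int p_pr).
Local Notation P := (p%:R : {poly Zp}).

Lemma padic_quo_ex (x : Zp) : exists y, x = padic_lift p_pr (red x) + p%:R * y.
Proof.
have [y yE] : exists y, x - padic_lift p_pr (red x) = p%:R * y.
  by apply: red_eq0; rewrite rmorphB /= red_padic_lift subrr.
by exists y; rewrite -yE addrC subrK.
Qed.

Definition padic_quo (x : Zp) : Zp := projT1 (cid (padic_quo_ex x)).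

Lemma padic_quoE x : x = padic_lift p_pr (red x) + p%:R * padic_quo x.
Proof. exact: projT2 (cid (padic_quo_ex x)). Qed.

(** The coefficient of [p] in the expansion of [x]; [red x] and [dig1 x] together amount to [x]
    modulo [p^2]. *)
Definition dig1 (x : Zp) : 'F_p := red (padic_quo x).

Lemma red_pM (x : Zp) : red (p%:R * x) = 0.
Proof. by rewrite rmorphM /= red_p mul0r. Qed.

Lemma digitsP (x : Zp) (a b : 'F_p) :
  (red x = a /\ dig1 x = b) <->
  exists z, x = padic_lift p_pr a + p%:R * padic_lift p_pr b + (p ^ 2)%:R * z.
Proof.
split=> [[<- <-]|[z zE]].
  exists (padic_quo (padic_quo x));
    rewrite {1}(padic_quoE x) {1}(padic_quoE (padic_quo x)).
  by rewrite natrX /dig1; ring.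
have ra : red x = a.
  by rewrite zE !rmorphD natrX expr2 -mulrA /= !red_pM red_padic_lift !addr0.
split=> //; have := padic_quoE x; rewrite ra {1}zE -addrA => /addrI.
rewrite natrX expr2 -mulrA -mulrDr => /(mulfI (p_neq0 p_pr)).
by rewrite /dig1 => <-; rewrite rmorphD /= red_pM red_padic_lift addr0.
Qed.

Definition digits (c : 'rV[Zp]_n) : 'rV['F_p]_n * 'rV['F_p]_n :=
  (map_mx (@red p p_pr) c, map_mx dig1 c).

Definition of_digits (ab : 'rV['F_p]_n * 'rV['F_p]_n) : 'rV[Zp]_n :=
  \row_i (padic_lift p_pr (ab.1 0 i) + p%:R * padic_lift p_pr (ab.2 0 i)).

Lemma digits_eqP c ab : digits c = ab <->
  forall i, exists z, c 0 i = of_digits ab 0 i + (p ^ 2)%:R * z.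
Proof.
split=> [<- i|H].
  by have /digitsP [z zE] := conj (erefl (red (c 0 i))) (erefl (dig1 (c 0 i)));
     exists z; rewrite !mxE.
case: ab H => a b H; congr (_, _); apply/rowP => i; rewrite mxE;
  by have [z] := H i; rewrite mxE => zE; have /digitsP [] : exists z, c 0 i =
    padic_lift p_pr (a 0 i) + p%:R * padic_lift p_pr (b 0 i) + (p ^ 2)%:R * z
      by exists z.
Qed.

(** The fibres are the cosets of the vectors divisible by [p^2]; translation invariance will give
    them equal measure. *)
Lemma digits_fibreE ab : [set c | digits c = ab] =
  [set of_digits ab + u | u in [set c | digits c = digits 0]].
Proof.
have d0 : of_digits (digits 0) = 0.
  apply/rowP => i; rewrite !mxE rmorph0 padic_lift0 add0r.
  have [_ /(_ _)] := digitsP 0 0 0 => -[|_ ->];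
    last by rewrite padic_lift0 mulr0.
  by exists 0; rewrite padic_lift0 !mulr0 !addr0.
apply/seteqP; split=> [c /digits_eqP H|_ [u /digits_eqP H <-]].
  exists (c - of_digits ab) => /=; last by rewrite addrC subrK.
  apply/digits_eqP => i; have [z zE] := H i; exists z.
  by rewrite d0 !mxE zE mxE addrAC subrr.
apply/digits_eqP => i; have [z zE] := H i; exists z.
by rewrite [LHS]mxE zE d0 [X in _ + (X + _)]mxE add0r.
Qed.

Lemma open_digits_fibre ab : open [set c | digits c = ab].
Proof.
rewrite openE => c /= cab.
(* Residues are indexed from the exponent 1, so index 1 means modulo [p^2]. *)
exists (fun i j => [set y : Zp | padic_res y 1 = padic_res (c i j) 1]) => /=.
  by move=> i j; exists 1%N.
move=> N /= H; apply/digits_eqP => i.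
have [z zE] := (digits_eqP c ab).1 cab i.
have [w wE] : exists w, N 0 i - c 0 i = (p ^ 2)%:R * w.
  by apply: padic_res_eq0; rewrite -[LHS]/(padic_res (N 0 i) 1 - padic_res (c 0
    i) 1) H subrr.
exists (z + w); rewrite mulrDr -wE addrA -zE addrC subrK //.
Qed.

Lemma measurable_digits_fibre ab :
  measurable ([set c | digits c = ab] : set (borel_padic p_pr n)).
Proof. by apply: sub_sigma_algebra; exact: open_digits_fibre. Qed.

Lemma haar_digits (R : realType) (mu : probability (borel_padic p_pr n) R)
    (Q : pred ('rV['F_p]_n * 'rV['F_p]_n)) : is_haar mu ->
  fine (mu [set c | Q (digits c)]) = #|Q|%:R / #|{: 'rV['F_p]_n *
    'rV['F_p]_n}|%:R.
Proof.
move=> haar.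
apply: (@probability_equal_fibres R _ (borel_padic p_pr n) mu _ digits).
  exact: measurable_digits_fibre.
have H ab : mu [set c | digits c = ab] = mu [set c | digits c = digits 0].
  by rewrite digits_fibreE haar //; exact: measurable_digits_fibre.
by move=> i j; rewrite !H.
Qed.

Definition reduction (a : 'rV['F_p]_n) : {poly 'F_p} := 'X^n + rVpoly a.

Lemma monic_reduction a : reduction a \is monic.
Proof.
rewrite monicE lead_coefDl ?lead_coefXn // size_polyXn ltnS.
by rewrite size_poly.
Qed.

Lemma size_reduction a : size (reduction a) = n.+1.
Proof. by rewrite size_polyDl size_polyXn // ltnS size_poly. Qed.

(** For [f] of degree [n] the bound [n.+1] on sizes loses no factor; [setprod (sqset f)] is the [s]
    of Dedekind's criterion. *)
Definition sqset (f : {poly 'F_p}) : {set {poly_n.+1 'F_p}} :=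
  finset (fun u : {poly_n.+1 'F_p} => mirr (polyn u) && (polyn u ^+ 2 %| f)).

Lemma sqset_mirr f u : u \in sqset f -> mirr (polyn u).
Proof. by rewrite inE => /andP []. Qed.

Lemma sqr_setprod_sqset f : setprod (sqset f) ^+ 2 %| f.
Proof.
rewrite dvdp_setprodX; last exact: sqset_mirr.
by apply/forall_inP => u; rewrite inE => /andP [].
Qed.

Lemma size_setprod_sqset a : (size (setprod (sqset (reduction a))) <= n.+1)%N.
Proof.
apply: (@leq_trans (size (reduction a))); last by rewrite size_reduction.
rewrite dvdp_leq ?monic_neq0 ?monic_reduction //.
by apply: dvdp_trans (sqr_setprod_sqset _); rewrite expr2 dvdp_mulIl.
Qed.

Lemma monic_ofE (c : 'rV[Zp]_n) : monic_of c =
  'X^n + rVpoly (map_mx (padic_lift p_pr) (digits c).1) + P * rVpoly (map_mx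
    padic_quo c).
Proof.
rewrite /monic_of rVpoly_sum -addrA; congr (_ + _).
apply/polyP => i; rewrite coefD -polyC_natr coefCM.
have [ni|ni] := ltnP i n; last by rewrite !nth_default ?(leq_trans (size_poly _
  _)) // mulr0 addr0.
rewrite -[i]/(nat_of_ord (Ordinal ni)) !coef_rVpoly_ord !mxE.
exact: padic_quoE.
Qed.

Lemma monic_of_monic (c : 'rV[Zp]_n) : monic_of c \is monic.
Proof.
rewrite /monic_of rVpoly_sum monicE lead_coefDl ?lead_coefXn // size_polyXn
  ltnS.
by rewrite size_poly.
Qed.

Lemma size_monic_of (c : 'rV[Zp]_n) : size (monic_of c) = n.+1.
Proof. by rewrite /monic_of rVpoly_sum size_polyDl size_polyXn // ltnS
  size_poly. Qed.

Lemma redp_monic_of (c : 'rV[Zp]_n) : redp (monic_of c) = reduction (digits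
  c).1.
Proof.
by rewrite /monic_of rVpoly_sum rmorphD rmorphXn /= /redp map_polyX map_rVpoly.
Qed.

(* The shift [h] is the class of [(f_0 - S^2 A) / p] modulo [p], where [f_0], *)
(* [S] and [A] lift [reduction a], the product [s] and [reduction a / s^2].    *)
Lemma maximal_digitsP (a : 'rV['F_p]_n) : (0 < n)%N ->
  exists h : {poly 'F_p}, forall c : 'rV[Zp]_n, (digits c).1 = a ->
    is_maximal_order (equation_order (monic_of c)) <->
    coprimep (setprod (sqset (reduction a))) (h + rVpoly (digits c).2).
Proof.
move=> n0; set s := setprod _.
have /dvdpP [A0 A0E] := sqr_setprod_sqset (reduction a); rewrite -/s in A0E.
pose S := liftp p_pr s; pose A := liftp p_pr A0.
have [H HE] : exists H, 'X^n + rVpoly (map_mx (padic_lift p_pr) a) = S ^+ 2 * A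
  + P * H.
  apply: redp_eq; rewrite rmorphM rmorphXn /= !liftpK mulrC -A0E.
  rewrite rmorphD rmorphXn /= /redp map_polyX map_rVpoly; congr (_ + rVpoly _).
  by apply/rowP => i; rewrite !mxE /= red_padic_lift.
exists (redp H) => c ca.
have fm := monic_of_monic c.
have fE : monic_of c = S ^+ 2 * A + P * (H + rVpoly (map_mx padic_quo c)).
  by rewrite monic_ofE ca HE mulrDr addrA.
set W := H + _ in fE.
have WE : redp H + rVpoly (digits c).2 = redp W.
  rewrite /W rmorphD /= /redp map_rVpoly; congr (_ + rVpoly _).
  by apply/rowP => i; rewrite !mxE.
rewrite WE; have rf := redp_monic_of c; rewrite ca in rf.
have smirr := @sqset_mirr (reduction a).
rewrite maximal_equation_orderP ?size_monic_of //; split=> [noU|cop].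
  rewrite coprimep_setprod //; apply/forall_inP => u us; apply/negP => uW;
    apply: noU.
  have su : polyn u %| s by rewrite /s /setprod (bigD1 u) //= dvdp_mulIl.
  pose U := liftp p_pr (polyn u).
  have lin Y : polyn u %| redp Y -> exists Y1 Y2, Y = U * Y1 + P * Y2.
    move=> /dvdpP [q qE].
    have [e ->] : exists e, Y = U * liftp p_pr q + P * e.
      by apply: redp_eq; rewrite rmorphM /= !liftpK qE mulrC.
    by exists (liftp p_pr q), e.
  have [W1 [W2 W12]] := lin _ uW.
  have [S1 [S2 S12]] : exists Y1 Y2, S = U * Y1 + P * Y2 by apply: lin;
    rewrite liftpK.
  (* Expansion of [S^2 A + P W] with [S = U S1 + P S2] and [W = U W1 + P W2]. *)
  exists U, (S1 ^+ 2 * A), (2 * S1 * S2 * A + W1), (S2 ^+ 2 * A + W2); split.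
    by rewrite liftpK; exact/mirr_irr/smirr.
  by rewrite fE W12 S12; ring.
move=> [U [X [Y [Z [Uirr fU]]]]].
have U0 : redp U != 0 by case: Uirr; rewrite -size_poly_gt0 => /ltnW.
pose v := (lead_coef (redp U))^-1 *: redp U.
have mv : mirr v := mirr_scale Uirr.
have lU : (lead_coef (redp U))^-1 != 0 by rewrite invr_eq0 lead_coef_eq0.
have vE z : (v %| z) = (redp U %| z) by rewrite dvdpZl.
have U2f : redp U ^+ 2 %| reduction a.
  rewrite -rf fU !(rmorphD, rmorphM, rmorphXn) /= redp_P expr0n !mul0r !addr0.
  by rewrite dvdp_mulIl.
have v2f : v ^+ 2 %| reduction a by rewrite exprZn dvdpZl // expf_neq0.
have vs : v %| s.
  have sv : (size v <= n.+1)%N.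
    rewrite -(size_reduction a) dvdp_leq ?monic_neq0 ?monic_reduction //.
    by apply: dvdp_trans v2f; rewrite expr2 dvdp_mulIl.
  have vin : npolyp n.+1 v \in sqset (reduction a) by rewrite inE npolypK // mv.
  by rewrite /s /setprod (bigD1 (npolyp n.+1 v)) //= npolypK // dvdp_mulIl.
have [S1 [S2 S12]] : exists Y1 Y2, S = U * Y1 + P * Y2.
  have /dvdpP [q qE] : redp U %| s by rewrite -vE.
  have [e ->] : exists e, S = U * liftp p_pr q + P * e.
    by apply: redp_eq; rewrite rmorphM /= !liftpK qE mulrC.
  by exists (liftp p_pr q), e.
have PW : P * W = U ^+ 2 * (X - S1 ^+ 2 * A) +
    P * (U * (Y - 2 * S1 * S2 * A) + P * (Z - S2 ^+ 2 * A)).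
  have -> : P * W = monic_of c - S ^+ 2 * A by rewrite fE addrAC subrr add0r.
  by rewrite fU S12; ring.
(* Reducing [PW] modulo [p] shows that the cofactor of [U^2] is divisible by [P]; after division by
   [P], the reduction of [W] is a multiple of that of [U]. *)
have [X' X'E] : exists X', X - S1 ^+ 2 * A = P * X'.
  apply: redp_eq0; have := congr1 (@redp p p_pr) PW.
  rewrite rmorphM /= redp_P mul0r rmorphD rmorphM rmorphXn /= [redp (P *
    _)]rmorphM /= redp_P mul0r addr0.
  by move/esym/eqP; rewrite mulf_eq0 expf_eq0 (negPf U0) andbF /= => /eqP.
have WU : W = U * (U * X' + (Y - 2 * S1 * S2 * A)) + P * (Z - S2 ^+ 2 * A).
  by apply: (mulfI (P_neq0 p_pr)); rewrite PW X'E; ring.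
have vW : v %| redp W.
  rewrite vE WU rmorphD rmorphM /= [redp (P * _)]rmorphM /= redp_P mul0r addr0.
  by rewrite dvdp_mulIl.
have : coprimep v (redp W) by apply: coprimep_dvdr cop.
by rewrite mirr_coprime // vW.
Qed.


Definition ffpoly (a : {ffun 'I_n -> 'F_p}) : {poly 'F_p} :=
  \sum_(i < n) a i *: 'X^(n - i.+1).

(** Vectors list coefficients by increasing degree, the tuples of [A_set] by decreasing degree;
    reversing the indices passes from one convention to the other. *)
Lemma reduction_rev (a : {ffun 'I_n -> 'F_p}) :
  reduction (\row_i a (rev_ord i)) = 'X^n + ffpoly a.
Proof.
rewrite /reduction -rVpoly_sum /ffpoly; congr (_ + _).
rewrite [RHS](reindex_inj rev_ord_inj) /=; apply: eq_bigr => i _.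
by rewrite mxE subnSK // subKn // ltnW.
Qed.

Lemma rev_row_bij :
  bijective (fun a : {ffun 'I_n -> 'F_p} => \row_i a (rev_ord i)).
Proof.
exists (fun c : 'rV_n => [ffun i => c 0 (rev_ord i)]).
  by move=> a; apply/ffunP => i; rewrite ffunE mxE rev_ordK.
by move=> c; apply/rowP => i; rewrite mxE ffunE rev_ordK.
Qed.

Lemma forall_rev_row (a : {ffun 'I_n -> 'F_p}) :
  [forall i, (\row_i a (rev_ord i)) 0 i != 0] = [forall i, a i != 0].
Proof.
apply/forallP/forallP => H i; last by rewrite mxE.
by have := H (rev_ord i); rewrite mxE rev_ordK.
Qed.

Lemma card_all_nonzero :
  #|[pred a : {ffun 'I_n -> 'F_p} | [forall i, a i != 0]]| = (p.-1 ^ n)%N.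
Proof.
have <- : #|predC1 (0 : 'F_p)| = p.-1 by rewrite cardC1 card_Fp.
rewrite -[n in RHS]card_ord -card_ffun_on; apply: eq_card => a.
apply/idP/idP => [/forallP H|/ffun_onP H]; first by apply/ffun_onP => i;
  exact: H.
by apply/forallP => i; exact: H.
Qed.

(** Membership in [U_set] depends on the first digits only. Given these, maximality is a coprimality
    condition on the second digits, and [card_coprime_setprod] counts the solutions. *)
Lemma PmaxE (R : realType) (mu : probability (borel_padic p_pr n) R) :
  (0 < n)%N -> is_haar mu ->
  Pmax mu = (p.-1%:R ^+ n)^-1 *
    \sum_(a : {ffun 'I_n -> 'F_p} | [forall i, a i != 0])
      \prod_(u in sqset ('X^n + ffpoly a)) (1 - wt R (polyn u)).
Proof.
move=> n0 haar.
have /choice [h hP] a := maximal_digitsP a n0.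
pose QU (ab : 'rV['F_p]_n * 'rV['F_p]_n) := [forall i, ab.1 0 i != 0].
pose QM (ab : 'rV['F_p]_n * 'rV['F_p]_n) :=
  coprimep (setprod (sqset (reduction ab.1))) (h ab.1 + rVpoly ab.2).
have UE : U_set p_pr n = [set c | QU (digits c)].
  apply/seteqP; split=> c /= H.
    apply/forallP => i; rewrite mxE; apply/eqP => /red_eq0 [z zE].
    by apply: (H i); exists z.
  move=> i [z zE]; move/forallP: H => /(_ i); rewrite mxE zE red_pM eqxx //.
have ME : U_set p_pr n `&` max_set p_pr n = [set c | (predI QU QM) (digits c)].
  rewrite UE; apply/seteqP; split=> c /=.
    by move=> [-> /(hP _ _ erefl)].
  by case/andP => Uc Mc; split=> //; apply/(hP _ _ erefl).
rewrite /Pmax ME UE !haar_digits //.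
set cT := #|{: _ * _}|%:R.
have p0 : p%:R != 0 :> R by rewrite pnatr_eq0 -lt0n prime_gt0.
have p10 : p.-1%:R != 0 :> R.
  by rewrite pnatr_eq0 -lt0n; have := prime_gt1 p_pr; case: (p) => [|[]].
have cT0 : cT != 0.
  by rewrite /cT pnatr_eq0 -lt0n; apply/card_gt0P; exists (0, 0).
have cU : #|QU|%:R = p.-1%:R ^+ n * p%:R ^+ n :> R.
  rewrite -sum1_card natr_sum.
  transitivity (\sum_(a : 'rV['F_p]_n | [forall i, a 0 i != 0])
     \sum_(b : 'rV['F_p]_n | true) 1%:R : R).
    by rewrite pair_big_dep /=; apply: eq_bigl => -[a b] /=; rewrite andbT.
  rewrite (reindex _ (onW_bij _ rev_row_bij)).
  under eq_bigl do rewrite forall_rev_row.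
  under eq_bigr do rewrite sumr_const card_mx mul1n card_Fp // mulr1n.
  by rewrite sumr_const card_all_nonzero -[LHS]mulr_natl !natrX.
have cM : #|predI QU QM|%:R = p%:R ^+ n *
    \sum_(a : {ffun 'I_n -> 'F_p} | [forall i, a i != 0])
      \prod_(u in sqset ('X^n + ffpoly a)) (1 - wt R (polyn u)).
  rewrite -sum1_card natr_sum.
  transitivity (\sum_(a : 'rV['F_p]_n | [forall i, a 0 i != 0])
     \sum_(b | QM (a, b)) 1%:R : R).
    by rewrite pair_big_dep /=; apply: eq_bigl => -[a b]; rewrite inE.
  rewrite (reindex _ (onW_bij _ rev_row_bij)).
  under eq_bigl do rewrite forall_rev_row.
  rewrite mulr_sumr; apply: eq_bigr => a Ua; rewrite -reduction_rev.
  set a' := \row_i _.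
  rewrite -[p%:R in RHS](_ : #|'F_p|%:R = _); last by rewrite card_Fp.
  rewrite -(@card_coprime_setprod _ R n _ _ (h a')); first 1 last.
  - exact: sqset_mirr.
  - exact: size_setprod_sqset.
  rewrite -sum1_card natr_sum (reindex (@npoly_rV _ n)); last first.
    by exists (@rVnpoly _ n) => b _; [exact: npoly_rV_K | exact: rVnpolyK].
  by apply: eq_bigl => b; rewrite inE /QM /= poly_rV_K // size_npoly.
rewrite cU cM; set S := \sum_(a | _) _.
have := expf_neq0 n p0; have := expf_neq0 n p10.
move: (p%:R ^+ n) (p.-1%:R ^+ n) => x y y0 x0.
by field; rewrite x0 y0 cT0.
Qed.

End Digits.

(** * The Moebius expansion *)

Section SetprodCount.
Variables (F : finFieldType) (N : nat).

Lemma mem_setprod (J : {set {poly_N F}}) u :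
  (forall u, u \in J -> mirr (polyn u)) -> mirr (polyn u) ->
  (polyn u %| setprod J) = (u \in J).
Proof.
move=> mJ mu; apply/idP/idP => [uJ|uJ]; last first.
  by rewrite /setprod (bigD1 u) //= dvdp_mulIl.
apply: contraLR uJ => uJ; rewrite -mirr_coprime // setprodE.
apply: mirr_notin_coprime => //.
  by apply/allP => _ /mapP [w wJ ->]; apply: mJ; rewrite mem_enum in wJ.
apply/negP => /mapP [w wJ /val_inj uw].
by rewrite uw -mem_enum wJ in uJ.
Qed.

(** By unique factorization [J] is recovered from [setprod J], and there are [#|F| ^ d] monic
    polynomials of degree [d]. *)
Lemma card_setprod_size d :
  (#|[pred J : {set {poly_N F}} | no_X J && (size (setprod J) == d.+1)]|
     <= #|F| ^ d)%N.
Proof.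
rewrite -card_npoly.
pose phi (J : {set {poly_N F}}) : {poly_d F} := npolyp d (setprod J - 'X^d).
have phiE J : no_X J -> size (setprod J) = d.+1 -> polyn (phi J) = setprod J -
  'X^d.
  move=> nJ sJ; rewrite npolypK //; apply/leq_sizeP => j dj.
  have vm : setprod J \is monic by exact/monic_setprod/no_X_mirr.
  rewrite coefB coefXn; move: dj; rewrite leq_eqVlt => /orP [/eqP <-|dj].
    by rewrite eqxx; move/monicP: vm; rewrite /lead_coef sJ => ->;
      rewrite subrr.
  by rewrite (gtn_eqF dj) subr0 nth_default // sJ.
rewrite -(@card_in_imset _ _ phi); first exact: max_card.
move=> J K; rewrite !inE => /andP [nJ /eqP sJ] /andP [nK /eqP sK] /(congr1
  (@polyn _ _)).
rewrite !phiE // => /addIr JK; apply/finset.setP => u.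
have mJ := no_X_mirr nJ; have mK := no_X_mirr nK.
apply/idP/idP => uin.
  by rewrite -(mem_setprod mK) ?mJ // -JK (mem_setprod mJ) ?mJ.
by rewrite -(mem_setprod mJ) ?mK // JK (mem_setprod mK) ?mK.
Qed.

End SetprodCount.

(** * Main term and error term of the average *)

Section OddPrime.
Variables (R : realType) (p : nat) (p_pr : prime p) (n : nat).
Hypothesis n0 : (0 < n)%N.
Local Notation F := 'F_p.
Local Notation fa a := ('X^n + @ffpoly p n a).
Implicit Types J : {set {poly_n.+1 F}}.

Let m := (n %/ 2)%N.
Let nz := [pred a : {ffun 'I_n -> F} | [forall i, a i != 0]].
Let cA : R := p.-1%:R ^+ n.

Let size_fa a : size (fa a) = n.+1.
Proof. by rewrite -reduction_rev size_reduction. Qed.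

Let fa_neq0 a : fa a != 0.
Proof. by rewrite -size_poly_gt0 size_fa. Qed.

Lemma X_ndvd_fa a : nz a -> ~~ ('X %| fa a)%R.
Proof.
move=> /= /forallP an.
have -> : ('X %| fa a)%R = root (fa a) 0 by rewrite -dvdp_XsubCl polyC0 subr0.
rewrite /root hornerD.
rewrite hornerXn expr0n eqn0Ngt n0 add0r /ffpoly horner_sum.
have ln : (n.-1 < n)%N by rewrite prednK.
rewrite (bigD1 (Ordinal ln)) //= big1 ?addr0 => [|i].
  by rewrite prednK // subnn expr0 hornerZ hornerC mulr1.
rewrite -val_eqE /= => iN; rewrite hornerZ hornerXn expr0n.
rewrite (_ : (n - i.+1 == 0)%N = false) ?mulr0 //.
by have := ltn_ord i; lia.
Qed.

Lemma sub_sqset a J : nz a ->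
  (J \subset sqset n (fa a)) = no_X J && (setprod J ^+ 2 %| fa a).
Proof.
move=> an; apply/fintype.subsetP/andP => [H|[nJ sJ] u uJ].
  have mJ u : u \in J -> mirr (polyn u) by move/H/sqset_mirr.
  split; last first.
    rewrite dvdp_setprodX //; apply/forall_inP => u /H.
    by rewrite inE => /andP [].
  apply/forall_inP => u uJ; rewrite mJ //=.
  apply: contraNneq (X_ndvd_fa an) => uX.
  have := H u uJ; rewrite inE => /andP [_]; apply: dvdp_trans.
  by rewrite expr2 uX dvdp_mulIl.
have mJ := no_X_mirr nJ.
rewrite inE mJ //=; move: sJ; rewrite dvdp_setprodX // => /forall_inP.
exact.
Qed.

Let rho J : R := #|[pred a in nz | (setprod J ^+ 2 %| fa a)%R]|%:R / cA.

(** The Moebius value of [v = setprod J] times [p^(- deg v)]; [rho J] is the probability that [v^2]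
    divides an admissible reduction. *)
Let mu J : R := (-1) ^+ #|J| * wt R (setprod J).

(** The product over [sqset] is expanded over its subsets and the sums are exchanged. If
    [deg v > n / 2] then [v^2] has degree larger than [n], so [rho] vanishes. *)
Lemma average_moebius :
  cA^-1 * \sum_(a in nz) \prod_(u in sqset n (fa a)) (1 - wt R (polyn u)) =
  \sum_(J | no_X J && (size (setprod J) <= m.+1)%N) mu J * rho J.
Proof.
transitivity (\sum_(J | no_X J) mu J * rho J); last first.
  rewrite (bigID (fun J => (size (setprod J) <= m.+1)%N)) /= [X in _ + X]big1
    ?addr0 //.
  move=> J /andP [nJ sJ].
  rewrite /rho eq_card0 ?mul0r ?mulr0 // => a; rewrite inE /=.
  apply/negP => /andP [_ /(dvdp_leq (fa_neq0 a))]; rewrite size_fa.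
  have vm : setprod J \is monic by exact/monic_setprod/no_X_mirr.
  rewrite -[size (setprod J ^+ 2)]prednK ?size_poly_gt0 ?expf_neq0 ?monic_neq0
    // size_exp ltnS.
  by move: sJ; rewrite /m; move: (size _) => s; lia.
rewrite mulr_sumr.
transitivity (\sum_(a in nz) \sum_(J : {set {poly_n.+1 F}} | J \subset sqset n
  (fa a)) cA^-1 * mu J).
  apply: eq_bigr => a an; rewrite prod_1B mulr_sumr; apply: eq_bigr => J JS.
  rewrite /mu wt_setprod // => u uJ.
  exact: sqset_mirr (fintype.subsetP JS u uJ).
rewrite (exchange_big_dep (@no_X F n.+1)) /=; last first.
  by move=> a J an; rewrite sub_sqset // => /andP [].
apply: eq_bigr => J nJ; rewrite sumr_const /rho -[LHS]mulr_natr [cA^-1 *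
  _]mulrC.
rewrite -mulrA [cA^-1 * _]mulrC; congr (_ * (_%:R * _)).
apply: eq_card => a; rewrite !inE /=.
by apply: andb_id2l => an; rewrite (@sub_sqset a J an) nJ.
Qed.

(** [v^2] divides [x^n + g] exactly when [g] is congruent to [- x^n] modulo [v^2]. As [x] does not
    divide [v^2], this is one of the terms maximized in [delta]. *)
Lemma rho_delta J d : no_X J -> size (setprod J) = d.+1 ->
  `| rho J - 1 / p%:R ^+ (2 * d) | <= delta R n p (2 * d).
Proof.
move=> nJ sJ; set v := setprod J in sJ *.
have vm : v \is monic by exact/monic_setprod/no_X_mirr.
have v0 := monic_neq0 vm.
have s2 : size (v ^+ 2) = (2 * d).+1.
  by rewrite -[LHS]prednK ?size_poly_gt0 ?expf_neq0 // size_exp sJ /= mulnC.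
pose u : {poly_(2 * d).+1 F} := npolyp _ (v ^+ 2).
have uE : polyn u = v ^+ 2 by rewrite npolypK // s2.
pose al : {poly_(2 * d) F} := npolyp _ (- 'X^n %% (v ^+ 2)).
have alE : polyn al = - 'X^n %% (v ^+ 2).
  by rewrite npolypK // -ltnS -s2 ltn_modp expf_neq0.
have Xv : ~~ ('X %| v ^+ 2)%R.
  apply/negP => /(mirr_dvdX (mirr_X F)); apply/negP.
  rewrite -(mirr_coprime _ (mirr_X F)) coprimep_sym coprimep_setprod;
    last exact: no_X_mirr.
  apply/forall_inP => w wJ; apply/negP => /(mirr_dvd_eq (no_X_mirr nJ wJ)
    (mirr_X F)) wX.
  by move/forall_inP: nJ => /(_ w wJ); rewrite wX eqxx andbF.
have rhoE : rho J = #|A_set n (polyn u) (polyn al)|%:R / (p.-1)%:R ^+ n.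
  congr (_%:R / _); apply: eq_card => a; rewrite !inE uE alE /=; congr (_ && _).
  rewrite modp_id -subr_eq0 -modpN -modpD opprK addrC.
  by [].
rewrite rhoE /delta.
pose E (w : {poly_(2 * d).+1 F}) (alpha : {poly_(2 * d) F}) : R :=
  `| #|A_set n (polyn w) (polyn alpha)|%:R / (p.-1)%:R ^+ n - 1 / p%:R ^+ (2 *
    d) |.
pose G (w : {poly_(2 * d).+1 F}) : R := \big[Num.max/0]_(alpha : {poly_(2 * d)
  F}) E w alpha.
have cu : [&& polyn u \is monic, size (polyn u) == (2 * d).+1 & ~~ ('X %| polyn
  u)].
  by rewrite uE rpredX //= s2 eqxx.
apply: (@le_trans _ _ (G u)); first exact: (le_bigmax _ (E u) al).
exact: (@le_bigmax_cond _ _ _ _ _ _ G cu).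
Qed.

Let pR0 : (p%:R : R) != 0.
Proof. by rewrite pnatr_eq0 -lt0n prime_gt0. Qed.

Let wtE J d : size (setprod J) = d.+1 -> wt R (setprod J) = p%:R^-1 ^+ d.
Proof. by rewrite /wt card_Fp // => ->. Qed.

Lemma sum_by_size (G : {set {poly_n.+1 F}} -> R) :
  \sum_(J | no_X J && (size (setprod J) <= m.+1)%N) G J =
  \sum_(0 <= d < m.+1) \sum_(J | no_X J && (size (setprod J) == d.+1)) G J.
Proof.
rewrite big_mkord.
rewrite (partition_big (fun J => inord (size (setprod J)).-1 : 'I_m.+1) predT)
  //=.
apply: eq_bigr => d _; apply: eq_bigl => J; rewrite -andbA.
case nJ : (no_X J) => //=.
have : (0 < size (setprod J))%N.
  by rewrite size_poly_gt0; exact/monic_neq0/monic_setprod/no_X_mirr.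
case: (size (setprod J)) => // s _ /=; rewrite eqSS ltnS.
have [sm|sm] := leqP s m; first by rewrite -val_eqE /= inordK.
by rewrite /=; have := ltn_ord d; case: eqP => // <-; rewrite ltnS leqNgt sm.
Qed.

(** The weight [p^(-d)] and the expected probability [p^(-2d)] combine into [p^(-3d)]; [moebius_sum]
    gives the other factor when [d > 0]. *)
Lemma moebius_sum_real d : (d <= m)%N ->
  \sum_(J | no_X J && (size (setprod J) == d.+1)) mu J * p%:R^-1 ^+ (2 * d) =
  (if d == 0%N then 1 else 1 - p%:R) * p%:R^-1 ^+ (3 * d).
Proof.
move=> dm.
transitivity ((\sum_(J : {set {poly_n.+1 F}} | no_X J && (size (setprod J) ==
  d.+1)) (-1) ^+ #|J|) *
     (p%:R : R)^-1 ^+ (3 * d)).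
  rewrite mulr_suml; apply: eq_bigr => J /andP [nJ /eqP sJ].
  by rewrite /mu (wtE sJ) -mulrA -exprD; congr (_ * _ ^+ _); lia.
congr (_ * _); case: eqP => [->|/eqP d0].
  rewrite (big_pred1 finset.set0) ?cards0 // => J.
  apply/andP/eqP => [[nJ /eqP sJ]|->]; last first.
    rewrite /setprod big_set0 size_poly1; split=> //.
    by apply/forall_inP => u; rewrite inE.
  apply/eqP; rewrite -finset.subset0; apply/fintype.subsetP => u uJ.
  have mJ := no_X_mirr nJ; have := mirr_size (mJ u uJ).
  have := mem_setprod mJ (mJ u uJ); rewrite uJ => /dvdp_leq.
  by rewrite monic_neq0 ?monic_setprod // sJ => /(_ isT);
    rewrite leqNgt => /negbTE ->.
have dN : (0 < d < n.+1)%N by rewrite lt0n d0 ltnS (leq_trans dm) // leq_div.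
have /(congr1 (fun z : int => z%:~R : R)) := moebius_sum F dN.
rewrite rmorph_sum /= card_Fp // rmorphB rmorph1 /= rmorph_nat => <-.
by apply: eq_bigr => J _; rewrite rmorph_sign.
Qed.

(** As [p^3 - 1 = (p - 1)(p^2 + p + 1)], the infinite series has value [1 - 1 / (p^2 + p + 1)]; the
    last term comes from truncating it. *)
Lemma geometric_sum k :
  \sum_(0 <= d < k.+1) (if d == 0%N then 1 else 1 - p%:R) * (p%:R : R)^-1 ^+ (3
    * d) =
  1 - 1 / (p ^ 2 + p + 1)%:R + p%:R^-1 ^+ (3 * k) / (p ^ 2 + p + 1)%:R.
Proof.
have s0 : (p ^ 2 + p + 1)%:R != 0 :> R by rewrite pnatr_eq0 addn1.
have sE : (p ^ 2 + p + 1)%:R = p%:R ^+ 2 + p%:R + 1 :> R by rewrite !natrD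
  natrX.
rewrite sE in s0 *.
elim: k => [|k IH]; first by rewrite big_nat1 muln0 expr0 mulr1 subrK.
rewrite big_nat_recr //= IH mulnS addnC exprD exprVn [in RHS]exprVn.
set x := (p%:R ^+ (3 * k))^-1.
by field; rewrite pR0 s0.
Qed.

(** In degree [d] there are at most [p^d] sets [J], each of weight [p^(-d)] in absolute value, so
    [delta (2 d)] enters with total coefficient at most 1. *)
Lemma average_bound :
  `| cA^-1 * \sum_(a in nz) \prod_(u in sqset n (fa a)) (1 - wt R (polyn u))
     - (1 - 1 / (p ^ 2 + p + 1)%:R) |
  <= \sum_(0 <= d < m.+1) delta R n p (2 * d) + 1 / p%:R ^+ n.
Proof.
rewrite average_moebius sum_by_size.
pose M := \sum_(0 <= d < m.+1)
  \sum_(J | no_X J && (size (setprod J) == d.+1)) mu J * p%:R^-1 ^+ (2 * d).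
have ME : M = 1 - 1 / (p ^ 2 + p + 1)%:R + p%:R^-1 ^+ (3 * m) / (p ^ 2 + p +
  1)%:R.
  rewrite -geometric_sum /M; apply: eq_big_nat => d /andP [_ dm].
  exact: moebius_sum_real.
set S := \sum_(0 <= d < m.+1) _.
have -> : S - (1 - 1 / (p ^ 2 + p + 1)%:R) =
    (S - M) + p%:R^-1 ^+ (3 * m) / (p ^ 2 + p + 1)%:R by rewrite ME; ring.
apply: (le_trans (ler_normD _ _)); apply: lerD; last first.
  rewrite ger0_norm; last by rewrite divr_ge0 ?exprn_ge0 ?invr_ge0 ?ler0n.
  rewrite exprVn -invfM div1r -natrX -natrM -natrX lef_pV2 ?posrE ?ltr0n;
    first 1 last.
  - by rewrite muln_gt0 expn_gt0 prime_gt0 // addn1.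
  - by rewrite expn_gt0 prime_gt0.
  (* The truncation term is at most [p^(-n)], because [n <= 3 m + 2] and [p^2 <= p^2 + p + 1]. *)
  rewrite ler_nat (@leq_trans (p ^ (3 * m + 2))) ?leq_exp2l ?prime_gt1 //.
    by rewrite /m; lia.
  by rewrite expnD leq_mul2l; apply/orP; right; lia.
rewrite /S /M -sumrB; apply: (le_trans (ler_norm_sum _ _ _));
  apply: ler_sum_nat => d _.
rewrite -sumrB; apply: (le_trans (ler_norm_sum _ _ _)).
have dge0 : 0 <= delta R n p (2 * d).
  exact: bigmax_ge_id.
apply: (@le_trans _ _ (\sum_(J | no_X J && (size (setprod J) == d.+1))
    p%:R^-1 ^+ d * delta R n p (2 * d))).
  apply: ler_sum => J /andP [nJ /eqP sJ].
  rewrite -mulrBr normrM normrM normrX normrN1 expr1n mul1r (wtE sJ).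
  rewrite ger0_norm ?exprn_ge0 ?invr_ge0 ?ler0n // ler_wpM2l ?exprn_ge0
    ?invr_ge0 ?ler0n //.
  by have := rho_delta nJ sJ; rewrite div1r exprVn.
rewrite sumr_const -[leLHS]mulr_natl mulrA ler_piMl // exprVn.
rewrite ler_pdivrMr ?exprn_gt0 ?ltr0n ?prime_gt0 // mul1r -natrX ler_nat.
by have := @card_setprod_size F n.+1 d; rewrite card_Fp.
Qed.

End OddPrime.

(** * The prime 2 *)

Section XOrder.
Variable F : finFieldType.
Implicit Types v : {poly F}.

(** [d] is the multiplicative order of [x] modulo [v]. *)
Definition xord v d :=
  [&& (0 < d)%N, v %| 'X^d - 1 & [forall e : 'I_d, (0 < e)%N ==> ~~ (v %| 'X^e
    - 1)%R]].

Lemma dvdp_Xn_sub1_mul v d k : v %| 'X^d - 1 -> v %| 'X^(d * k) - 1.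
Proof. by move=> vd; rewrite exprM subrX1 dvdp_mulr. Qed.

Lemma xord_dvd v d k : xord v d -> (v %| 'X^k - 1) = (d %| k)%N.
Proof.
case/and3P => d0 vd /forallP vmin; apply/idP/idP => [vk|/dvdnP [l ->]];
  last first.
  by rewrite mulnC dvdp_Xn_sub1_mul.
rewrite (divn_eq k d) in vk; have rd : (k %% d < d)%N by rewrite ltn_mod.
have : v %| 'X^(k %% d) - 1.
  have -> : 'X^(k %% d) - 1 =
      ('X^(k %/ d * d + k %% d) - 1) - 'X^(k %% d) * ('X^(d * (k %/ d)) - 1) :>
        {poly F}.
    by rewrite exprD [(d * _)%N]mulnC; ring.
  by rewrite dvdp_sub // dvdp_mull // dvdp_Xn_sub1_mul.
move=> vr; have := vmin (Ordinal rd); rewrite /= vr implybF -eqn0Ngt.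
by [].
Qed.

Lemma xord_exists v k : (0 < k)%N -> v %| 'X^k - 1 -> exists d, xord v d.
Proof.
move=> k0 vk; have ex : exists d, (0 < d)%N && (v %| 'X^d - 1) by exists k;
  rewrite k0.
case: (ex_minnP ex) => d /andP [d0 vd] dmin; exists d; rewrite /xord d0 vd.
apply/forallP => e; apply/implyP => e0; apply/negP => ve.
by have := dmin e; rewrite e0 ve leqNgt ltn_ord => /(_ isT).
Qed.

Lemma xord_uniq v d e : xord v d -> xord v e -> d = e.
Proof.
move=> vd ve; apply/eqP; rewrite eqn_dvd -(xord_dvd _ vd) -(xord_dvd _ ve).
by case/and3P: vd => _ -> _; case/and3P: ve => _ -> _.
Qed.

Lemma big_xord N t (A : Type) (idx : A) (op : Monoid.com_law idx) (G : {poly_N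
  F} -> A) :
  (0 < t)%N ->
  \big[op/idx]_(u : {poly_N F} | mirr (polyn u) && (polyn u %| 'X^t - 1)%R) G u
    =
  \big[op/idx]_(d < t.+1 | (d %| t)%N) \big[op/idx]_(u : {poly_N F} | mirr
    (polyn u) && xord (polyn u) d) G u.
Proof.
(* The default [ord0] is never reached when [u] divides [X^t - 1]: the order of [x] then divides
   [t]. *)
move=> t0; pose xo (u : {poly_N F}) := odflt ord0 [pick d : 'I_t.+1 | xord
  (polyn u) d].
have xoP u : (polyn u %| 'X^t - 1) -> xord (polyn u) (xo u).
  move=> ut; have [d ud] := xord_exists t0 ut.
  have dt : (d < t.+1)%N by rewrite ltnS dvdn_leq // -(xord_dvd _ ud).
  by rewrite /xo; case: pickP => //= /(_ (Ordinal dt)); rewrite ud.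
rewrite (partition_big xo (fun d => (d %| t)%N)) /=; last first.
  by move=> u /andP [_ ut]; rewrite -(xord_dvd _ (xoP u ut)).
apply: eq_bigr => d dt; apply: eq_bigl => u; rewrite -andbA;
  apply: andb_id2l => mu.
apply/andP/idP => [[ut /eqP <-]|ud]; first exact: xoP.
have ut : polyn u %| 'X^t - 1 by rewrite (xord_dvd _ ud).
split=> //; apply/eqP/val_inj; exact: xord_uniq (xoP u ut) ud.
Qed.

Lemma size_setprod N (J : {set {poly_N F}}) : (forall u, u \in J -> mirr (polyn
  u)) ->
  (size (setprod J)).-1 = (\sum_(u in J) (size (polyn u)).-1)%N.
Proof.
move=> mJ; suff [] : (size (setprod J)).-1 = (\sum_(u in J) (size (polyn
  u)).-1)%N /\
  setprod J != 0 by [].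
rewrite /setprod; apply: (big_ind2 (fun (z : {poly F}) (x : nat) => (size z).-1
  = x /\ z != 0)).
- by rewrite size_poly1 oner_neq0.
- move=> z1 x1 z2 x2 [<- z10] [<- z20]; split; last by rewrite mulf_neq0.
  rewrite size_mul //; move: z10 z20; rewrite -!size_poly_gt0.
  by case: (size z1) => // a; case: (size z2) => // b _ _; rewrite addSn addnS.
- by move=> u uJ; split=> //; exact/mirr_neq0/mJ.
Qed.

Lemma sqr_ndvd_Xn_sub1 (w : {poly F}) t : (t%:R : F) != 0 -> mirr w -> ~~ (w ^+
  2 %| 'X^t - 1)%R.
Proof.
move=> tF mw; apply/negP => w2.
have /separable_polyP [sep _] := separable_Xn_sub_1 tF.
by have := sep w w; rewrite -expr2 w2 mirr_coprime // dvdpp => /(_ isT).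
Qed.

(** [X^t - 1] is squarefree, hence equal up to a constant to the product of its monic irreducible
    factors. *)
Lemma sum_degree_Xn_sub1 N t : (t%:R : F) != 0 -> (0 < t < N)%N ->
  (\sum_(u : {poly_N F} | mirr (polyn u) && (polyn u %| 'X^t - 1)%R) (size
    (polyn u)).-1)%N = t.
Proof.
move=> tF /andP [t0 tN].
pose T : {set {poly_N F}} := finset (fun u => mirr (polyn u) && (polyn u %|
  'X^t - 1)%R).
have mT u : u \in T -> mirr (polyn u) by rewrite inE => /andP [].
transitivity (\sum_(u in T) (size (polyn u)).-1)%N;
  first by apply: eq_bigl => u; rewrite inE.
rewrite -size_setprod //.
have sX : size ('X^t - 1 : {poly F}) = t.+1 by rewrite size_XnsubC.
have X0 : 'X^t - 1 != 0 :> {poly F} by rewrite -size_poly_gt0 sX.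
have /dvdpP [c cE] : setprod T %| 'X^t - 1.
  by rewrite dvdp_setprod //; apply/forall_inP => u; rewrite inE => /andP [].
have c0 : c != 0 by apply: contraNneq X0 => c0; rewrite cE c0 mul0r.
have [c1|c1] := leqP (size c) 1; last first.
  have [w mw wc] := exists_mirr c1.
  have wX : w %| 'X^t - 1 by rewrite cE dvdp_mulr.
  have sw : (size w <= N)%N by rewrite (leq_trans _ tN) // -sX dvdp_leq.
  have wT : npolyp N w \in T by rewrite inE npolypK // mw.
  have wv : w %| setprod T by rewrite -[w](@npolypK _ N) // mem_setprod // mT.
  by have := sqr_ndvd_Xn_sub1 tF mw; rewrite expr2 cE dvdp_mul.
have s1 : size c = 1%N by apply/eqP; rewrite eqn_leq c1 size_poly_gt0.
move: sX; rewrite cE size_mul // ?s1 ?add1n /=;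
  last exact/monic_neq0/monic_setprod.
by move=> ->.
Qed.

End XOrder.

(** * Irreducible factors over the field with two elements *)

Section TwoField.
Local Notation F := 'F_2.

Lemma F2_neq0 (c : F) : c != 0 -> c = 1.
Proof. by case: c => [[|[|k]] lt] //= _; exact: val_inj. Qed.

Lemma ord2_dvd d m : odd d -> (ord2 d %| m)%N = (d %| 2 ^ m - 1)%N.
Proof.
move=> od; rewrite /ord2; case: leqP => d1.
  have -> : d = 1%N by case: d od d1 => [|[]].
  by rewrite !dvd1n.
have u2 : (2%:R : 'Z_d) \is a GRing.unit by rewrite unitZpE // coprimen2.
rewrite order_dvdn -val_eqE /= FinRing.val_unitX val_insubd u2 /=.
rewrite -natrX -[X in _ == X]/(1%:R) -val_eqE /= !val_Zp_nat // Zp_cast //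
  eqn_mod_dvd //.
by rewrite expn_gt0.
Qed.

Lemma ord2_gt0 d : (0 < ord2 d)%N.
Proof. by rewrite /ord2; case: (leqP d 1) => // _; exact: order_gt0. Qed.

Lemma natr_odd t : odd t -> (t%:R : F) != 0.
Proof. by move=> ot; rewrite -(dvdn_pcharf (pchar_Fp (isT : prime 2))) dvdn2
  ot. Qed.

Section Degree.
Variables (w : {poly F}) (mw : mirr w).
Let hI : monic_irreducible_poly w := (mirr_irr mw, mirr_monic mw).
Local Notation L := {poly %/ w with hI}.
Let q (g : {poly F}) : L := in_qpoly w g.

Let mkw : mk_monic w = w. Proof. exact: mk_monicE hI. Qed.

Let q_eq0 g : (q g == 0) = (w %| g).
Proof.
apply/eqP/idP => [/(congr1 val) /=|wg].
  by rewrite mkw -Pdiv.IdomainMonic.modpE ?mirr_monic // => /eqP.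
apply: val_inj; rewrite /= mkw -Pdiv.IdomainMonic.modpE ?mirr_monic //.
exact/eqP.
Qed.

Let q_surj (y : L) : exists g, y = q g.
Proof.
exists (polyn y); apply: val_inj; rewrite /= Pdiv.Ring.rmodp_small //.
exact: size_mk_monic.
Qed.

Let cardL : #|L| = (2 ^ (size w).-1)%N.
Proof. by rewrite card_qfpoly card_Fp. Qed.

Lemma mirr_dvd_XX k : w != 'X -> (0 < k)%N -> (w %| 'X^k - 'X) = (w %|
  'X^(k.-1) - 1).
Proof.
move=> wX; case: k => // k _ /=.
have -> : 'X^(k.+1) - 'X = 'X * ('X^k - 1) :> {poly F} by rewrite exprS; ring.
rewrite mirr_dvdM //; case: (boolP (w %| 'X)) => // /(mirr_dvd_eq mw (mirr_X
  _)) e.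
by rewrite e eqxx in wX.
Qed.

(** [w] divides [X^(2^k) - X] exactly when [ord2 d] divides [k]. The field [L] has [2^e] elements,
    so [k = e] qualifies and [ord2 d <= e]. Conversely, for [o = ord2 d], the [2^o]-th power map
    fixes the class of [x], which generates [L]; so the polynomial [X^(2^o) - X] has [2^e] roots in
    [L], and [e <= o]. *)
Lemma degree_xord d : w != 'X -> odd d -> xord w d -> (size w).-1 = ord2 d.
Proof.
move=> wX od wd; set e := (size w).-1.
have e0 : (0 < e)%N by have := mirr_size mw; rewrite /e;
  case: (size w) => [|[]].
have crit k : (0 < k)%N -> (w %| 'X^(2 ^ k) - 'X) = (ord2 d %| k)%N.
  by move=> k0; rewrite mirr_dvd_XX ?expn_gt0 // (xord_dvd _ wd) ord2_dvd //
    subn1.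
apply/eqP; rewrite eqn_leq; apply/andP; split; last first.
  apply: dvdn_leq => //; rewrite -crit // -q_eq0 /q rmorphB rmorphXn /=.
  by rewrite -cardL (expf_card (q 'X : L)) subrr.
set o := ord2 d; have o0 : (0 < o)%N := ord2_gt0 d.
have wo : w %| 'X^(2 ^ o) - 'X by rewrite crit.
have pL : [pchar L].-nat (2 ^ o)%N.
  rewrite pnatX; apply/orP; left; rewrite pnatE //.
  by rewrite (pchar_qpoly w) pchar_Fp.
have fixL (y : L) : y ^+ (2 ^ o) = y.
  have [g ->] := q_surj y; elim/poly_ind: g => [|g c IH].
    by rewrite /q rmorph0 expr0n eqn0Ngt expn_gt0.
  have qE : q (g * 'X + c%:P) = q g * q 'X + q c%:P by rewrite /q rmorphD
    rmorphM.
  rewrite qE exprDn_pchar // exprMn IH; congr (_ * _ + _).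
    by apply/eqP; rewrite -subr_eq0 /q -rmorphXn -rmorphB /=; move: wo;
      rewrite -q_eq0.
  have [->|/F2_neq0 ->] := eqVneq c 0.
    by rewrite /q rmorph0 expr0n eqn0Ngt expn_gt0.
  by rewrite /q rmorph1 expr1n.
have o1 : (1 < 2 ^ o)%N by rewrite -(expn0 2) ltn_exp2l.
pose Q : {poly L} := 'X^(2 ^ o) - 'X.
have sQ : size Q = (2 ^ o).+1 by rewrite size_polyDl ?size_polyXn // size_polyN
  size_polyX ltnS.
have Q0 : Q != 0 by rewrite -size_poly_gt0 sQ.
have := max_poly_roots Q0 (_ : all (root Q) (enum L)) (enum_uniq L).
rewrite -cardE cardL sQ ltnS leq_exp2l //; apply.
by apply/allP => y _; rewrite /root /Q !hornerE fixL subrr.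
Qed.

End Degree.

Lemma xord_neq_X d (w : {poly F}) : xord w d -> w != 'X.
Proof.
case/and3P => d0 wd _; apply/eqP => wX; move: wd; rewrite wX.
have -> : ('X %| ('X^d - 1 : {poly F}))%R = root ('X^d - 1 : {poly F}) (0 : F)
  by rewrite -dvdp_XsubCl polyC0 subr0.
rewrite /root !hornerE expr0n.
by rewrite eqn0Ngt d0 sub0r oppr_eq0 oner_eq0.
Qed.

(** Both sides, summed over the divisors of [t], give [t]: the left side is then the sum of the
    degrees of the factors of [X^t - 1]. Strong induction cancels the proper divisors. *)
Lemma card_xord N t : odd t -> (t < N)%N ->
  (ord2 t * #|[pred u : {poly_N F} | mirr (polyn u) && xord (polyn u) t]|)%N =
    totient t.
Proof.
elim/ltn_ind: t => t IH ot tN; have t0 : (0 < t)%N := odd_gt0 ot.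
pose c d := #|[pred u : {poly_N F} | mirr (polyn u) && xord (polyn u) d]|.
have S1 : (\sum_(d < t.+1 | (d %| t)%N) ord2 d * c d)%N = t.
  rewrite -[RHS](@sum_degree_Xn_sub1 F N t) ?natr_odd ?t0 // big_xord //.
  apply: eq_bigr => d dt; rewrite /c -sum1_card big_distrr /=.
  apply: eq_bigr => u /andP [mu ud]; rewrite muln1.
  rewrite (degree_xord mu _ _ ud) ?(xord_neq_X ud) //.
  exact: dvdn_odd dt ot.
have := esym (sum_totient_dvd t); rewrite -[X in X = _ -> _]S1.
rewrite (bigD1 (@ord_max t)) //= [X in _ = X -> _](bigD1 (@ord_max t)) //= =>
  /eqP.
rewrite (eq_bigr (fun d : 'I_t.+1 => totient d)) ?eqn_add2r; first by move/eqP.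
move=> d /andP [dt dmax]; apply: IH.
- by rewrite ltn_neqAle -ltnS ltn_ord andbT; move: dmax; rewrite -val_eqE.
- exact: dvdn_odd dt ot.
- by rewrite (leq_ltn_trans _ tN) // dvdn_leq.
Qed.

Lemma prod_mirr_Xn_sub1 (R : realType) N t : odd t -> (t < N)%N ->
  \prod_(u : {poly_N F} | mirr (polyn u) && (polyn u %| 'X^t - 1)%R) (1 - wt R
    (polyn u))
  = p_t R t.
Proof.
move=> ot tN; have t0 := odd_gt0 ot; rewrite big_xord // /p_t.
have -> : \prod_(d <- divisors t) (1 - (2^-1 : R) ^+ ord2 d) ^+ (totient d %/
  ord2 d) =
  \prod_(d < t.+1 | (d %| t)%N) (1 - (2^-1 : R) ^+ ord2 d) ^+ (totient d %/
    ord2 d).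
  rewrite -(big_mkord (fun d => (d %| t)%N) (fun d => (1 - (2^-1 : R) ^+ ord2
    d) ^+ (totient d %/ ord2 d))).
  rewrite -[RHS]big_filter; apply: perm_big; apply: uniq_perm.
  - exact: divisors_uniq.
  - by rewrite filter_uniq // iota_uniq.
  - move=> d; rewrite -dvdn_divisors // mem_filter mem_index_iota /=.
    by case dt : (d %| t)%N => //=; rewrite ltnS dvdn_leq.
apply: eq_bigr => d dt; have od := dvdn_odd dt ot.
have dN : (d < N)%N by rewrite (leq_ltn_trans _ tN) // dvdn_leq.
rewrite -(card_xord od dN) mulKn ?ord2_gt0 // -prodr_const; apply: eq_bigr => u.
move=> /andP [mu ud]; rewrite /wt card_Fp // (degree_xord mu _ od ud) //.
exact: xord_neq_X ud.
Qed.

Variables (R : realType) (n : nat).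
Hypothesis n2 : (2 <= n)%N.
Let t := (n.+1`_2^')%N.
Let k := logn 2 n.+1.
Let f : {poly F} := 'X^n + ffpoly [ffun _ : 'I_n => 1].

Let nE : n.+1 = (t * 2 ^ k)%N.
Proof. by rewrite -p_part mulnC partnC. Qed.

Let t_odd : odd t.
Proof.
have : (negn (2%N : nat_pred)).-nat t := part_pnat _ _; rewrite p'natE //.
by rewrite dvdn2 negbK.
Qed.

Let fE : f = \sum_(i < n.+1) 'X^i.
Proof.
rewrite big_ord_recr /= addrC /f /ffpoly; congr (_ + _).
rewrite [RHS](reindex_inj rev_ord_inj) /=; apply: eq_bigr => i _.
by rewrite ffunE scale1r.
Qed.

Let pcharP : [pchar {poly F}].-nat (2 ^ k)%N.
Proof.
rewrite pnatX; apply/orP; left; rewrite pnatE //.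
by rewrite pchar_poly pchar_Fp.
Qed.

Let fX : ('X - 1) * f = ('X^t - 1) ^+ (2 ^ k).
Proof.
rewrite fE -subrX1 nE exprM.
have := exprDn_pchar ('X^t - 1) 1 pcharP; rewrite subrK expr1n => ->.
by rewrite addrK.
Qed.

Let h : {poly F} := \sum_(i < t) 'X^i.
Let hE : 'X^t - 1 = ('X - 1) * h. Proof. exact: subrX1. Qed.

Let m1 : mirr ('X - 1 : {poly F}).
Proof. by rewrite -polyC1; exact: mirr_XsubC. Qed.

(** The factor [X - 1] occurs once less than the factors of [h], which is what sets the case [k = 1]
    apart. *)
Let fh : f = ('X - 1) ^+ (2 ^ k).-1 * h ^+ (2 ^ k).
Proof.
apply: (mulfI (mirr_neq0 m1)); rewrite fX hE exprMn mulrA -exprS prednK //.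
by rewrite expn_gt0.
Qed.

Let ndvd_h : ~~ ('X - 1 %| h)%R.
Proof.
apply/negP => X1h; have := sqr_ndvd_Xn_sub1 (natr_odd t_odd) m1.
by move/negP; apply; rewrite hE expr2 dvdp_mul2l ?mirr_neq0.
Qed.

Let dvd_f w : mirr w -> w ^+ 2 %| f -> w %| 'X^t - 1.
Proof.
move=> mw w2; apply: (@mirr_dvdX _ _ _ (2 ^ k)) => //; rewrite -fX dvdp_mull //.
by apply: dvdp_trans w2; rewrite expr2 dvdp_mulIl.
Qed.

(** For [k = 0], [f] divides the squarefree [X^t - 1] and the product is empty. For [k = 1], the
    squares of all the factors of [X^t - 1] except [X - 1] divide [f], and the missing factor
    [1 - 1/2] accounts for the 2. For larger [k] the multiplicity of [X - 1] is at least 3, and no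
    factor is missing. *)
Lemma prod_sqset_two :
  \prod_(u in sqset n f) (1 - wt R (polyn u)) =
  if odd n.+1 then 1 else if (n.+1 %% 4 == 2)%N then 2 * p_t R t else p_t R t.
Proof.
have bigE (Q : pred {poly_n.+1 F}) :
    (forall u, mirr (polyn u) -> (polyn u ^+ 2 %| f)%R = Q u) ->
    \prod_(u in sqset n f) (1 - wt R (polyn u)) =
    \prod_(u | mirr (polyn u) && Q u) (1 - wt R (polyn u)).
  move=> H; apply: eq_bigl => u; rewrite inE; apply: andb_id2l; exact: H.
have [k0|kpos] := posnP k.
  have nt : n.+1 = t by rewrite {1}nE k0 muln1.
  have -> : odd n.+1 by rewrite nt t_odd.
  rewrite (bigE pred0) ?big_pred0 // => u; first by rewrite andbF.
  move=> mu; apply/negP => u2f.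
  have := sqr_ndvd_Xn_sub1 (natr_odd t_odd) mu.
  have <- : ('X - 1) * f = 'X^t - 1 by rewrite fX k0 expr1.
  by rewrite dvdp_mull.
have tn : (t < n.+1)%N.
  rewrite nE -{1}[t]muln1 ltn_pmul2l ?odd_gt0 //.
  by rewrite -{1}(expn0 2) ltn_exp2l.
have -> : odd n.+1 = false by rewrite nE oddM oddX t_odd eqn0Ngt kpos.
have [k1|k1] := eqVneq k 1%N.
  have -> : (n.+1 %% 4 == 2)%N.
    by rewrite nE k1 -(odd_double_half t) t_odd; lia.
  have X1n : (size ('X - 1 : {poly F})%R <= n.+1)%N.
    by rewrite -polyC1 size_XsubC; lia.
  rewrite (bigE (fun u => (polyn u %| 'X^t - 1)%R && (u != npolyp n.+1 ('X -
    1)))).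
    rewrite -(prod_mirr_Xn_sub1 R t_odd tn) [in RHS](bigD1 (npolyp n.+1 ('X -
      1))) /=; last first.
      by rewrite npolypK // m1 hE dvdp_mulIl.
    rewrite npolypK // /wt -[in size _]polyC1 size_XsubC card_Fp // expr1.
    rewrite mulrA (_ : 2 * (1 - 2^-1) = 1) ?mul1r; last by field.
    by apply: eq_bigl => u; rewrite andbA.
  move=> u mu; have fh1 : f = ('X - 1) * h ^+ 2 by rewrite fh k1 expr1.
  apply/idP/andP => [u2|[uX u1]].
    split; first exact: dvd_f.
    apply/eqP => uE; move: u2; rewrite uE npolypK // fh1 expr2.
    rewrite dvdp_mul2l ?mirr_neq0 // => /(mirr_dvdX m1).
    by rewrite (negPf ndvd_h).
  move: uX; rewrite hE mirr_dvdM // => /orP [/(mirr_dvd_eq mu m1) uE|uh].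
    by case/eqP: u1; apply: val_inj; rewrite /= npolypK.
  by rewrite fh1 dvdp_mull // dvdp_exp2r.
have k2 : (1 < k)%N by lia.
have k4 : (4 %| 2 ^ k)%N by rewrite -[4%N]/(2 ^ 2)%N dvdn_exp2l.
have -> : (n.+1 %% 4 == 2)%N = false.
  have /dvdnP [l lE] := k4; rewrite nE lE mulnA modnMl //.
have k3 : (4 <= 2 ^ k)%N by rewrite dvdn_leq // expn_gt0.
rewrite (bigE (fun u => (polyn u %| 'X^t - 1)%R)) ?(prod_mirr_Xn_sub1 R t_odd
  tn) // => u mu.
apply/idP/idP => [|]; first exact: dvd_f.
rewrite hE mirr_dvdM // fh => /orP [u1|uh]; [apply: dvdp_mulr|apply: dvdp_mull].
  by apply: (@dvdp_trans _ (('X - 1) ^+ 2));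
    rewrite ?dvdp_exp2r // dvdp_exp2l //; lia.
by apply: (@dvdp_trans _ (h ^+ 2)); rewrite ?dvdp_exp2r // dvdp_exp2l //; lia.
Qed.

End TwoField.

Theorem theorem3p2 (R : realType) :
  (forall (n : nat) (mu : probability (borel_padic (isT : prime 2) n) R),
     (2 <= n)%N -> is_haar mu ->
     let t := (n.+1`_2^')%N in
     Pmax mu = if odd n.+1 then 1
               else if (n.+1 %% 4 == 2)%N then 2 * p_t R t
               else p_t R t) /\
  (exists C : R,
     forall (p : nat) (p_pr : prime p) (n : nat)
            (mu : probability (borel_padic p_pr n) R),
       odd p -> (2 <= n)%N -> is_haar mu ->
       `| Pmax mu - (1 - 1 / (p ^ 2 + p + 1)%:R) |
         <= C * (\sum_(0 <= d < (n %/ 2).+1) delta R n p (2 * d)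
                 + 1 / p%:R ^+ n)).
Proof.
split=> [n mu n2 haar t|].
  rewrite PmaxE ?(ltnW n2) // expr1n invr1 mul1r.
  (* Over the field with two elements the only tuple of nonzero coefficients is constantly 1, so the
     average has a single term. *)
  rewrite (big_pred1 [ffun=> 1]); first exact: prod_sqset_two.
  move=> a; apply/forallP/eqP => [a1|-> i]; last by rewrite ffunE.
  by apply/ffunP => i; rewrite ffunE; exact: F2_neq0.
(* The bound of [average_bound] holds with implied constant 1. *)
exists 1 => p p_pr n mu _ n2 haar; have n0 := ltnW n2.
by rewrite [1 * (_ + _)]mul1r PmaxE //; exact: (average_bound R p_pr n0).
Qed.
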